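(* Let $X$ be a real reflexive Banach space, $P\subset X$ a cone, and $J:X\to\mathbb R$ a locally Lipschitz functional. Suppose that for some $\mu_0\in(0,1)$: (a) $(I-\nabla J)\big(\partial D^{+}(\mu_0)\big)\subset D^{+}(\tfrac12\mu_0)$ and $(I-\nabla J)\big(\partial D^{-}(\mu_0)\big)\subset D^{-}(\tfrac12\mu_0)$; (b) $J$ satisfies the non-smooth $C$-condition on $X$ with respect to $X$, on $D^+(\tfrac34\mu_0)$ with respect to $D^+(\mu_0)$, on $D^-(\tfrac34\mu_0)$ with respect to $D^-(\mu_0)$, and on $D^+(\mu_0)\cap D^-(\mu_0)$ with respect to $X$. Let $W=D^+(\mu_0)\cup D^-(\mu_0)$ and $S=X\setminus W$. Let $(Q,T)$ be linking, with $T\subset X\setminus W$ and $Q\subset X$ compact, and set $$\Gamma=\{\gamma\in C(Q,X):\ \gamma|_{\partial Q\cap S}=I,\ \gamma(\partial Q\cap W)\subset W\}.$$ Assume that $\gamma(Q)\cap S\neq\emptyset$ for each $\gamma\in\Gamma$, that there exist $\beta>\alpha$ such that $$\sup_{x\in\partial Q\cap S}J(x)\le\alpha<\beta\le\inf_{x\in T}J(x),$$ and that $\sup_{x\in Q}J(x)<\infty$. Let $$r=\inf_{\gamma\in\Gamma}\ \sup_{x\in\gamma(Q)\cap S}J(x).$$ Then $r\ge\beta$ and $\mathbb K_r\cap S\ne\emptyset$; that is, there is $x\in X\setminus W$ with $0\in\partial J(x)$ and $J(x)=r$.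
   Context: $X^*$ is the dual of $X$ with norm $\|\cdot\|_*$. A cone $P$ in $X$ is a closed convex set with $\lambda x\in P$ for all $x\in P$, $\lambda\ge0$, and $P\cap(-P)=\{0\}$. For $\mu>0$, $D^{\pm}(\mu)=\{x\in X:\operatorname{dist}(x,\pm P)\le\mu\}$. For a set $D\subset X$, $\partial D$ denotes its boundary; for a functional, $\partial J(x)\subset X^*$ is the Clarke generalized subdifferential of $J$ at $x$. The duality map $\mathscr F:X^*\to2^X$ is $\mathscr F(x^* )=\{x\in X:\langle x^*,x\rangle=\|x^*\|_*^2=\|x\|^2\}$, and $\nabla J(x):=\mathscr F(\partial J(x))=\bigcup_{x^*\in\partial J(x)}\mathscr F(x^* )$. $I$ is the identity; $(I-\nabla J)(A)\subset B$ means $x-y\in B$ for all $x\in A$, $y\in\nabla J(x)$. For a nonempty closed convex $D\subset X$ and $x\in D$, $m_D(x)=\inf_{x^*\in\partial J(x)}\sup\{\langle x^*,x-y\rangle:y\in D,\ \|x-y\|<1\}$; for $D=X$ this is $m(x):=\inf\{\|x^*\|_*:x^*\in\partial J(x)\}$. For $D_1\subset D$, $J$ satisfies the non-smooth $C$-condition on $D_1$ with respect to $D$ if every sequence $\{x_n\}\subset D_1$ such that $J(x_n)\to c$ for some $c\in\mathbb R$ and $(1+\|x_n\|)m_D(x_n)\to0$ has a convergent subsequence. $\mathbb K_r=\{x\in X:m(x)=0,\ J(x)=r\}$ (note $m(x)=0$ iff $0\in\partial J(x)$). Linking: for closed subsets $Q,T$ of $X$, $(Q,T)$ is linking if (1)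 $\partial Q\cap T=\emptyset$, and (2) for each $\gamma\in C(Q,X)$ with $\gamma|_{\partial Q}=I$ one has $\gamma(Q)\cap T\ne\emptyset$. Here, for the linking set $Q$, $\partial Q$ denotes the relative boundary of $Q$, i.e. its boundary in its closed affine hull. A supremum over the empty set is $-\infty$. *)

(* Defs.v *)
From HB Require Import structures.
From mathcomp Require Import all_boot all_order all_algebra.
From mathcomp Require Import all_classical all_reals all_analysis.

Set Implicit Arguments.
Unset Strict Implicit.
Unset Printing Implicit Defensive.

Import Order.TTheory GRing.Theory Num.Theory.
Import numFieldNormedType.Exports.

Local Open Scope classical_set_scope.
Local Open Scope ring_scope.

Definition dual_pred (R : realType) (X : normedModType R) : {pred X -> R^o} :=
  fun f => `[< linear f /\ continuous f >].

Record dual (R : realType) (X : normedModType R) := Dual {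
  dual_fun :> X -> R^o ;
  dual_funP : dual_fun \in @dual_pred R X }.

Section dual_lmodule.
Context {R : realType} {X : normedModType R}.

Fact dual_submod_closed : submod_closed (@dual_pred R X).
Proof.
split=> [|a f g /asboolP[lf cf] /asboolP[lg cg]]; apply/asboolP; split.
- by move=> k u v; rewrite scaler0 addr0.
- exact: cst_continuous.
- move=> k u v; rewrite -[LHS]/(a *: f (k *: u + v) + g (k *: u + v)) lf lg.
  rewrite !scalerDr !scalerA mulrC -!addrA; congr (_ + _).
  by rewrite addrCA.
- move=> x; apply: cvgD (cg x).
  by apply: cvgZl_tmp; exact: cf.
Qed.

HB.instance Definition _ :=
  GRing.isSubmodClosed.Build R (X -> R^o) (@dual_pred R X) dual_submod_closed.

HB.instance Definition _ := [isSub for @dual_fun R X].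
HB.instance Definition _ := [Choice of dual X by <:].
HB.instance Definition _ := [SubChoice_isSubLmodule of dual X by <:].

End dual_lmodule.

Section dual_norm.
Context {R : realType} {X : normedModType R}.
Implicit Types f g : dual X.

Definition dual_norm f : R := sup [set `|f x| | x in [set x | `|x| <= 1]].

Fact dual_linear f : linear f.
Proof. by case: f => f /= /asboolP[]. Qed.

Fact dual_continuous f : continuous f.
Proof. by case: f => f /= /asboolP[]. Qed.

Fact dual_norm_has_sup f : has_sup [set `|f x| | x in [set x | `|x| <= 1]].
Proof.
split; first by exists `|f 0|, 0 => //=; rewrite normr0.
pose F : {linear X -> R^o} :=
  HB.pack (dual_fun f) (GRing.isLinear.Build _ _ _ _ _ (dual_linear f)).
have /linear_boundedP : bounded_near F (nbhs 0).
  by apply/linear_bounded_continuous; exact: dual_continuous.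
move=> /pinfty_ex_gt0[M M0 FM]; exists M => _ [x /= x1 <-].
by rewrite (le_trans (FM x))// ger_pMr.
Qed.

Fact dual_norm_ub f x : `|x| <= 1 -> `|f x| <= dual_norm f.
Proof.
by move=> x1; apply: ub_le_sup; [case: (dual_norm_has_sup f)|exists x].
Qed.

Fact dual_norm_le f M : (forall x, `|x| <= 1 -> `|f x| <= M) ->
  dual_norm f <= M.
Proof.
move=> fM; apply: ge_sup; first by case: (dual_norm_has_sup f).
by move=> _ [x x1 <-]; exact: fM.
Qed.

Fact dual_ler_normD f g : dual_norm (f + g) <= dual_norm f + dual_norm g.
Proof.
apply: dual_norm_le => x x1; rewrite -[(f + g) x]/(f x + g x).
by rewrite (le_trans (ler_normD _ _))// lerD// dual_norm_ub.
Qed.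

Fact dual_ler_normZ a f : dual_norm (a *: f) <= `|a| * dual_norm f.
Proof.
apply: dual_norm_le => x x1; rewrite -[(a *: f) x]/(a * f x) normrM.
by rewrite ler_wpM2l// dual_norm_ub.
Qed.

Fact dual_normrZ a f : dual_norm (a *: f) = `|a| * dual_norm f.
Proof.
apply/eqP; rewrite eq_le dual_ler_normZ /=.
have [->|a0] := eqVneq a 0.
  rewrite normr0 mul0r; apply: (le_trans (normr_ge0 ((0 *: f) 0))).
  by apply: dual_norm_ub; rewrite normr0.
rewrite -ler_pdivlMl ?normr_gt0// -normfV.
by apply: le_trans (dual_ler_normZ _ _); rewrite scalerA mulVf// scale1r.
Qed.

Fact dual_norm_eq0 f : dual_norm f = 0 -> f = 0.
Proof.
move=> f0; apply: val_inj; apply/funext => x /=; rewrite -[RHS]/(0 : R).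
have lf : scalable f.
  by move=> k u; have := dual_linear f k u 0; rewrite addr0 => ->;
     have := dual_linear f (-1) 0 0; rewrite scaler0 addr0 scaleN1r addNr => ->;
     rewrite addr0.
have [->|x0] := eqVneq x 0; first by rewrite -[in LHS](scale0r 0) lf scale0r.
have : `|f (`|x|^-1 *: x)| <= 0.
  by rewrite -f0; apply: dual_norm_ub; rewrite normrZ normfV normr_id mulVf// normr_eq0.
rewrite normr_le0 lf scaler_eq0 invr_eq0 normr_eq0 (negbTE x0) /=.
by move/eqP.
Qed.

HB.instance Definition _ := Lmodule_isNormed.Build R (dual X)
  dual_ler_normD dual_normrZ dual_norm_eq0.

End dual_norm.

Definition reflexive_space (R : realType) (X : normedModType R) :=
  forall phi : dual (dual X), exists x : X, forall f : dual X, phi f = f x.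

Section nonsmooth.
Context {R : realType} {X : normedModType R}.
Implicit Types (J : X -> R) (A B D P Q T : set X) (x y v : X).

Definition boundary {U : topologicalType} (A : set U) := closure A `\` A°.

Definition affine_set A :=
  forall x y (t : R), A x -> A y -> A ((1 - t) *: x + t *: y).

Definition closed_affine_hull A :=
  smallest (fun H => closed H /\ affine_set H) A.

(* In [subspace H] points outside H are isolated; since A `<=` H they belong
   neither to the closure of A nor to A itself, so this is a subset of H. *)
Definition rel_boundary A : set X :=
  @boundary (subspace (closed_affine_hull A)) A.

Definition cone P :=
  [/\ closed P, convex_set P,
      forall x (lambda : R), P x -> 0 <= lambda -> P (lambda *: x) &
      P `&` -%R @` P = [set 0]].

Definition Dpos P (mu : R) := [set x | (edist_inf P x <= mu%:E)%E].
Definition Dneg P (mu : R) := [set x | (edist_inf (-%R @` P) x <= mu%:E)%E].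

Definition locally_lipschitz J :=
  forall x, exists2 U, nbhs x U & [lipschitz (J y : R^o) | y in U].

(* J°(x; v) = limsup of (J (y + t v) - J y) / t as y --> x and t --> 0+ *)
Definition clarke_derivative J x v : \bar R :=
  limf_esup (fun p : X * R => ((J (p.1 + p.2 *: v) - J p.1) / p.2)%:E)
    (filter_prod (nbhs x) 0^'+).

Definition clarke_subdiff J x : set (dual X) :=
  [set f | forall v, ((f v : R)%:E <= clarke_derivative J x v)%E].

Definition duality_map (f : dual X) : set X :=
  [set x | f x = `|f| ^+ 2 /\ `|f| ^+ 2 = `|x| ^+ 2].

Definition grad J x : set X := \bigcup_(f in clarke_subdiff J x) duality_map f.

Definition id_minus_grad J A : set X :=
  \bigcup_(x in A) [set x - y | y in grad J x].

Definition mD J D x : \bar R :=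
  ereal_inf [set ereal_sup [set (f (x - y) : R)%:E | y in
                              [set y | D y /\ `|x - y| < 1]]
            | f in clarke_subdiff J x].

Definition mX J x : \bar R :=
  ereal_inf [set `|f|%:E | f in clarke_subdiff J x].

Definition C_condition J D1 D :=
  forall x_ : nat -> X, (forall n, D1 (x_ n)) ->
    (exists c : R, J (x_ n) @[n --> \oo] --> c) ->
    ((1 + `|x_ n|)%:E * mD J D (x_ n))%E @[n --> \oo] --> 0%E ->
  exists2 phi : nat -> nat, increasing_seq phi & cvgn (x_ \o phi).

(* r is an infimum in \bar R, so the level is compared there. *)
Definition critical_set J (r : \bar R) : set X :=
  [set x | mX J x = 0%E /\ (J x)%:E = r].

Definition linking Q T :=
  [/\ closed Q, closed T, rel_boundary Q `&` T = set0 &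
      forall gamma : X -> X, {within Q, continuous gamma} ->
        (forall x, rel_boundary Q x -> gamma x = x) ->
        gamma @` Q `&` T !=set0].

(* Elements of C(Q, X) are represented by total maps X -> X continuous on Q. *)
Definition Gamma Q W : set (X -> X) :=
  [set gamma | [/\ {within Q, continuous gamma},
     forall x, (rel_boundary Q `&` ~` W) x -> gamma x = x &
     gamma @` (rel_boundary Q `&` W) `<=` W]].

Definition minimax J Q W : \bar R :=
  ereal_inf [set ereal_sup [set (J x)%:E | x in gamma @` Q `&` ~` W]
            | gamma in Gamma Q W].

End nonsmooth.

(* Main.v *)
Require Import Defs.
From HB Require Import structures.
From mathcomp Require Import all_boot all_order all_algebra.
From mathcomp Require Import all_classical all_reals all_analysis.
From mathcomp Require Import ring lra.
Set Implicit Arguments.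
Unset Strict Implicit.
Unset Printing Implicit Defensive.
Import Order.TTheory GRing.Theory Num.Theory.
Import numFieldNormedType.Exports.
Local Open Scope classical_set_scope.
Local Open Scope ring_scope.

(**
The distances to P and -P are sublinear, so W is star-shaped and a radial
homotopy inside W deforms the boundary values of any gamma in Gamma to the
identity; hence gamma(Q) meets T, and r >= beta.

For the critical point no flow is used. On Gamma, ordered by
  g' <= g  iff  eps |g' x - g x| <= (1 + |gamma0 x|) (psi g - psi g')  on Q,
where psi g is the supremum of J over g(Q) \ W and gamma0 is nearly optimal,
every decreasing sequence has a lower bound, so there is a psi-minimal gamma1
below gamma0. If all points z of gamma1(Q) in the closure of S near level r
had (1 + |z|) |f| > 6 eps for every f in the subdifferential, then each z
would admit a direction u of uniform descent; by hypothesis (a) and the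
Mazur-Orlicz theorem u can be chosen to point into D+ and D- whenever z is on
their boundary. A partition of unity turns these directions into a
perturbation of gamma1 that preserves W and decreases psi by more than the
order allows. The C-condition then yields a critical point at level r in the
closure of S, and (a) excludes the boundary of W.
*)

(** * Sublinear functionals and the Hahn-Banach theorem *)

Section sublinear.
Context {R : realType} {V : lmodType R}.
Implicit Types (p q : V -> R) (K : set V) (x y v : V).

Lemma set1_convex y u v (l : R) :
  [set y] u -> [set y] v -> 0 <= l <= 1 -> [set y] (l *: u + (1 - l) *: v).
Proof. by move=> -> -> _ /=; rewrite -scalerDl addrC subrK scale1r. Qed.

(** Homogeneity is asked as one inequality for positive factors: applying it to [l] and to its
    inverse gives equality, and the factors 2 and 1/2 give [p 0 = 0]. *)
Definition sublinear p :=
  (forall x y, p (x + y) <= p x + p y) /\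
  (forall (l : R) x, 0 < l -> p (l *: x) <= l * p x).

Lemma sublinear0 p : sublinear p -> p 0 = 0.
Proof.
move=> [_ pZ]; have := pZ 2 0; have := pZ 2^-1 0.
by rewrite !scaler0 => /(_ ltac:(lra)) ? /(_ ltac:(lra)) ?; lra.
Qed.

Lemma sublinear_geN p x : sublinear p -> - p (- x) <= p x.
Proof.
move=> sp; have := sp.1 x (- x); rewrite subrr sublinear0//; lra.
Qed.

Lemma sublinearZ p (l : R) x : sublinear p -> 0 <= l -> p (l *: x) = l * p x.
Proof.
move=> sp; rewrite le_eqVlt => /predU1P[<-|l0].
  by rewrite scale0r mul0r sublinear0.
apply/eqP; rewrite eq_le sp.2//= -ler_pdivlMl//.
by apply: le_trans (sp.2 _ _ _); rewrite ?invr_gt0// scalerA mulVf ?gt_eqF// scale1r.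
Qed.

(** Infimal convolution of [p] with the value [- t * a] at [- t *: v], for [v] in [K]. A linear
    functional below it is below [p] and at least [a] on [K]. *)
Definition sublinear_lower p K (a : R) x : R :=
  inf [set p (x + t.1 *: t.2) - t.1 * a | t in [set t : R * V | 0 <= t.1 /\ K t.2]].

Section lower.
Variables (p : V -> R) (K : set V) (a : R) (v0 : V).
Hypotheses (sp : sublinear p) (Kv0 : K v0) (pa : forall v, K v -> a <= p v).
Hypothesis convK : forall u v (l : R), K u -> K v -> 0 <= l <= 1 ->
  K (l *: u + (1 - l) *: v).

Let E x := [set p (x + t.1 *: t.2) - t.1 * a | t in [set t : R * V | 0 <= t.1 /\ K t.2]].

(** Finiteness of the infimum: subadditivity gives [t * p v <= p (x + t *: v) + p (- x)], and
    [a <= p v] on [K]. *)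
Let Elb x : lbound (E x) (- p (- x)).
Proof.
move=> _ [[t v] /= [t0 Kv] <-].
have := sp.1 (x + t *: v) (- x); rewrite addrAC subrr add0r sublinearZ//.
by have := ler_wpM2l t0 (pa Kv); lra.
Qed.

Let Ehas x : has_inf (E x).
Proof.
split; last by exists (- p (- x)); exact: Elb.
by exists (p (x + 0 *: v0) - 0 * a), (0, v0).
Qed.

Lemma sublinear_lower_ub x (t : R) v : 0 <= t -> K v ->
  sublinear_lower p K a x <= p (x + t *: v) - t * a.
Proof. by move=> t0 Kv; apply: ge_inf; [case: (Ehas x)|exists (t, v)]. Qed.

Lemma sublinear_lower_le x : sublinear_lower p K a x <= p x.
Proof.
by have := @sublinear_lower_ub x 0 v0 (lexx _) Kv0; rewrite scale0r addr0 mul0r subr0.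
Qed.

Lemma sublinear_lowerN v : K v -> sublinear_lower p K a (- v) <= - a.
Proof.
move=> Kv; have := @sublinear_lower_ub (- v) 1 v ler01 Kv.
by rewrite scale1r addNr sublinear0// mul1r sub0r.
Qed.

(** Two competitors merge because [t *: v + s *: w] is [t + s] times a convex combination of [v] and
    [w]; the case [t + s = 0] reduces to domination by [p]. *)
Lemma sublinear_lower_sublinear : sublinear (sublinear_lower p K a).
Proof.
split=> [x y|l x l0].
  rewrite -lerBlDr; apply: lb_le_inf; first by case: (Ehas x).
  move=> _ [[t v] /= [t0 Kv] <-]; rewrite lerBlDr -lerBlDl.
  apply: lb_le_inf; first by case: (Ehas y).
  move=> _ [[s w] /= [s0 Kw] <-]; rewrite lerBlDl.
  have := sp.1 (x + t *: v) (y + s *: w).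
  have [ts0|ts0] := eqVneq (t + s) 0.
    have t00 : t = 0 by lra.
    have s00 : s = 0 by lra.
    rewrite t00 s00 !scale0r !addr0 !mul0r !subr0.
    by have := sublinear_lower_le (x + y); lra.
  have tsp : 0 < t + s by rewrite lt_def ts0 addr_ge0.
  have Kc := @convK v w (t / (t + s)) Kv Kw.
  have tsge : 0 <= t + s by lra.
  have := sublinear_lower_ub (x + y) tsge (Kc _).
  rewrite scalerDr !scalerA.
  have -> : (t + s) * (t / (t + s)) = t by rewrite mulrCA divff// mulr1.
  have -> : (t + s) * (1 - t / (t + s)) = s.
    by rewrite mulrBr mulr1 mulrCA divff// mulr1; lra.
  have -> : x + y + (t *: v + s *: w) = x + t *: v + (y + s *: w) by rewrite addrACA.
  move=> H1 H2; apply: le_trans (H1 _) _; last by lra.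
  by rewrite divr_ge0//= ler_pdivrMr// mul1r lerDl.
rewrite -ler_pdivrMl//; apply: lb_le_inf; first by case: (Ehas x).
move=> _ [[t v] /= [t0 Kv] <-]; rewrite ler_pdivrMl//.
have := @sublinear_lower_ub (l *: x) (l * t) v (mulr_ge0 (ltW l0) t0) Kv.
by rewrite -scalerA -scalerDr (sublinearZ _ sp (ltW l0)); lra.
Qed.

End lower.

(** The pointwise infimum works: it is finite since [- q (- x) <= p x], and subadditive since of two
    members of a chain the smaller one can be used for both summands. *)
Lemma sublinear_chain_lb (q : V -> R) (A : set (V -> R)) p0 : A p0 ->
  (forall p, A p -> sublinear p /\ (forall x, p x <= q x)) ->
  (forall p p', A p -> A p' ->
     (forall x, p x <= p' x) \/ (forall x, p' x <= p x)) ->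
  exists g, [/\ sublinear g, (forall x, g x <= q x) &
    forall p, A p -> forall x, g x <= p x].
Proof.
move=> Ap0 Aq Atot; pose E x := [set p x | p in A].
have Ehas x : has_inf (E x).
  split; first by exists (p0 x), p0.
  exists (- q (- x)) => _ [p /Aq[sp pq] <-].
  by apply: le_trans (sublinear_geN x sp); rewrite lerN2.
have gle p x : A p -> inf (E x) <= p x.
  by move=> Ap; apply: ge_inf; [case: (Ehas x)|exists p].
exists (fun x => inf (E x)); split.
- split=> [x y|l x l0].
    rewrite -lerBlDr; apply: lb_le_inf; first by case: (Ehas x).
    move=> _ [p Ap <-]; rewrite lerBlDr -lerBlDl.
    apply: lb_le_inf; first by case: (Ehas y).
    move=> _ [p' Ap' <-]; rewrite lerBlDl.
    have [h|h] := Atot _ _ Ap Ap'.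
      by have := gle _ (x + y) Ap; have := (Aq _ Ap).1.1 x y; have := h y; lra.
    by have := gle _ (x + y) Ap'; have := (Aq _ Ap').1.1 x y; have := h x; lra.
  rewrite -ler_pdivrMl//; apply: lb_le_inf; first by case: (Ehas x).
  move=> _ [p Ap <-]; rewrite ler_pdivrMl//.
  exact: le_trans (gle _ _ Ap) ((Aq _ Ap).1.2 _ _ l0).
- by move=> x; apply: le_trans (gle _ _ Ap0) ((Aq _ Ap0).2 x).
- by move=> p Ap x; exact: gle.
Qed.

(* A minimal sublinear functional is linear: lowering it along a single vector
   y gives a smaller sublinear functional, and equality forces additivity. *)
Lemma hahn_banach q : sublinear q ->
  exists2 f : V -> R, linear (f : V -> R^o) & forall x, f x <= q x.
Proof.
move=> sq.
pose T := {p : V -> R | sublinear p /\ forall x, p x <= q x}.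
(* The order is reversed, so a maximal element for Zorn's lemma is a minimal functional. *)
pose le (p p' : T) := `[< forall x, sval p' x <= sval p x >].
have [||||[f [sf fq]] fmin] := @Zorn T le.
- by move=> p; apply/asboolP.
- move=> p1 p2 p3 /asboolP h1 /asboolP h2; apply/asboolP => x.
  exact: le_trans (h2 x) (h1 x).
- move=> [p1 P1] [p2 P2] /asboolP/= h1 /asboolP/= h2.
  have p12 : p1 = p2 by apply/funext => x; apply/eqP; rewrite eq_le h1 h2.
  by subst p2; rewrite (Prop_irrelevance P1 P2).
- move=> A Atot; have [[p0 Ap0]|A0] := pselect (A !=set0); last first.
    exists (exist _ q (conj sq (fun x => lexx (q x)))) => s As.
    by exfalso; apply: A0; exists s.
  have [|_ [[p hp] _ <-] //|_ _ [p Ap <-] [p' Ap' <-]|g [sg gq gA]] :=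
    @sublinear_chain_lb q [set sval p | p in A] (sval p0).
  + by exists p0.
  + by have [/asboolP h|/asboolP h] := Atot _ _ Ap Ap'; [right|left].
  + exists (exist _ g (conj sg gq)) => s As; apply/asboolP => x /=.
    by apply: gA; exists s.
have fD x y : f (x + y) = f x + f y.
  have fa v : [set y] v -> f y <= f v by move=> ->.
  have sg := sublinear_lower_sublinear sf (erefl : [set y] y) fa (@set1_convex y).
  have gf := sublinear_lower_le sf (erefl : [set y] y) fa.
  have gq z : sublinear_lower f [set y] (f y) z <= q z.
    exact: le_trans (gf z) (fq z).
  have /(congr1 sval)/= gE :=
    fmin (exist _ _ (conj sg gq)) (asboolT gf).
  apply/eqP; rewrite eq_le sf.1/=.
  have := sublinear_lower_ub sf (erefl : [set y] y) fa x ler01 erefl.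
  by rewrite gE scale1r mul1r; lra.
have fN x : f (- x) = - f x.
  by have := fD x (- x); rewrite subrr sublinear0//; lra.
exists f => // l x y; rewrite fD; congr (_ + _).
have [l0|l0] := leP 0 l; first by rewrite sublinearZ.
rewrite -[l]opprK scaleNr fN sublinearZ ?oppr_ge0 ?(ltW l0)//.
by rewrite -mulNr.
Qed.

(** Hahn-Banach below the lowered functional, whose bound [- a] at [- v] turns into [a <= f v] by
    linearity. For empty [K] plain Hahn-Banach suffices. *)
Lemma mazur_orlicz q K (a : R) : sublinear q ->
  (forall u v (l : R), K u -> K v -> 0 <= l <= 1 ->
     K (l *: u + (1 - l) *: v)) ->
  (forall v, K v -> a <= q v) ->
  exists f : V -> R, [/\ linear (f : V -> R^o), forall x, f x <= q x &
    forall v, K v -> a <= f v].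
Proof.
move=> sq cK qa; have [[v0 Kv0]|K0] := pselect (K !=set0); last first.
  have [f lf fq] := hahn_banach sq; exists f; split=> // v Kv.
  by exfalso; apply: K0; exists v.
have [f lf fq] := hahn_banach (sublinear_lower_sublinear sq Kv0 qa cK).
have leq := sublinear_lower_le sq Kv0 qa.
exists f; split=> // [x|v Kv]; first exact: le_trans (fq x) (leq x).
have f0 : f 0 = 0 by have := lf (-1) 0 0; rewrite scaler0 addr0 scaleN1r addNr.
have fN : f (- v) = - f v :> R.
  by have := lf (-1) v 0; rewrite !scaleN1r !addr0 f0 addr0.
have := sublinear_lowerN sq Kv0 qa Kv; have := fq (- v).
by rewrite fN; lra.
Qed.

End sublinear.

(* The ordering principle of Brezis and Browder. *)
Lemma exists_order_minimal (R : realType) (T : Type) (le : T -> T -> Prop)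
    (psi : T -> R) (b : R) (x0 : T) :
  (forall x, le x x) -> (forall x y z, le x y -> le y z -> le x z) ->
  (forall x y, le x y -> psi x <= psi y) ->
  (forall x, le x x0 -> b <= psi x) ->
  (forall u : nat -> T, le (u 0%N) x0 -> (forall n, le (u n.+1) (u n)) ->
     exists l, forall n, le l (u n)) ->
  exists2 x, le x x0 & forall y, le y x -> psi x <= psi y.
Proof.
move=> lexx letr lepsi psib lelim.
(* The successor closes at least half of the gap between [psi x] and the infimum of [psi] below [x].
   That infimum is known to be finite only below [x0]; elsewhere [x] is its own successor. *)
have next x : exists y, le y x /\
    (le x x0 -> forall z, le z x -> psi y <= (psi z + psi x) / 2).
  have [xx0|nxx0] := pselect (le x x0); last by exists x.
  pose E := [set psi z | z in [set z | le z x]].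
  have hE : has_inf E.
    split; first by exists (psi x), x.
    by exists b => _ [z zx <-]; apply: psib; exact: letr zx xx0.
  have Ele z : le z x -> inf E <= psi z.
    by move=> zx; apply: ge_inf; [case: hE|exists z].
  have [Ex|Ex] := leP (psi x) (inf E).
    exists x; split=> // _ z zx; have := Ele _ zx; lra.
  have e0 : 0 < (psi x - inf E) / 2 by lra.
  have [_ [y yx <-] yE] := inf_adherent e0 hE.
  exists y; split=> // _ z zx; have := Ele _ zx; lra.
have [s sP] := choice next.
pose u n := iter n s x0.
have uS n : le (u n.+1) (u n) by have [] := sP (u n).
have u0 n : le (u n) x0 by elim: n => // n ih; apply: letr (uS n) ih.
have [l lu] := lelim u (u0 0%N) uS.
exists l; first exact: lu 0%N.
move=> y yl.
have psilu n : psi l <= psi (u n) by exact: lepsi.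
have psiy n : psi (u n.+1) <= (psi y + psi (u n)) / 2.
  by have [_ /(_ (u0 n) y)] := sP (u n); apply; exact: letr (lu n).
rewrite leNgt; apply/negP => yl'.
(* Since [y] is below every [u n], the gap to [psi y] halves at each step; it cannot stay above the
   positive number [psi l - psi y]. *)
have key n : psi (u n) - psi y <= (psi (u 0%N) - psi y) * 2^-1 ^+ n.
  elim: n => [|n ih]; first by rewrite expr0 mulr1.
  by rewrite exprS mulrCA; have := psiy n; lra.
have h : (psi (u 0%N) - psi y) * 2^-1 ^+ n @[n --> \oo] --> (psi (u 0%N) - psi y) * 0.
  apply: cvgM; first exact: cvg_cst.
  by apply: cvg_expr; rewrite ger0_norm; lra.
rewrite mulr0 in h.
have d0 : 0 < psi l - psi y by lra.
have /cvgrPdist_lt/(_ _ d0)[N _ /(_ N (leqnn N))] := h.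
rewrite sub0r normrN => /(le_lt_trans (ler_norm _)).
by have := key N; have := psilu N; lra.
Qed.

(** * Dual space and Clarke derivative *)

Section dual_space.
Context {R : realType} {X : normedModType R}.
Implicit Types (f : dual X) (x : X).

Lemma dual0 f : f 0 = 0.
Proof.
by have := dual_linear f (-1) 0 0; rewrite scaler0 addr0 scaleN1r addNr.
Qed.

Lemma dualZ f (a : R) x : f (a *: x) = a * f x.
Proof. by have := dual_linear f a x 0; rewrite addr0 dual0 addr0. Qed.

Lemma dualN f x : f (- x) = - f x.
Proof. by rewrite -scaleN1r dualZ mulN1r. Qed.

Lemma dual_norm_bound f x : `|f x| <= `|f| * `|x|.
Proof.
have [->|x0] := eqVneq x 0; first by rewrite dual0 !normr0 mulr0.
have nx : 0 < `|x| by rewrite normr_gt0.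
have := @dual_norm_ub _ _ f (`|x|^-1 *: x).
rewrite normrZ normfV normr_id mulVf ?gt_eqF// => /(_ (lexx _)).
by rewrite dualZ normrM normfV normr_id ler_pdivrMl// mulrC.
Qed.

(** A one-sided bound is enough: evaluated at [- x] it bounds the absolute value. *)
Lemma dual_of_bounded (f : X -> R) (L : R) : linear (f : X -> R^o) ->
  (forall x, f x <= L * `|x|) -> exists F : dual X, forall x, F x = f x.
Proof.
move=> lf fL.
pose G : {linear X -> R^o} :=
  HB.pack (f : X -> R^o) (GRing.isLinear.Build _ _ _ _ _ lf).
have fab x : `|f x| <= L * `|x|.
  rewrite ler_norml fL andbT lerNl -[- f x]/(- G x) -linearN.
  by rewrite -[`|x|]normrN; exact: fL.
have cG : continuous G.
  apply/linear_bounded_continuous/linear_boundedP.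
  near=> M => x; apply: le_trans (fab x) _.
  by apply: ler_wpM2r => //; near: M; exact: nbhs_pinfty_ge.
have fP : (f : X -> R^o) \in @dual_pred R X by apply/asboolP.
by exists (Dual fP).
Unshelve. all: by end_near. Qed.

Lemma normr_sublinear (V : normedModType R) : sublinear (fun x : V => `|x|).
Proof.
split=> [x y|l x l0]; first exact: ler_normD.
by rewrite normrZ gtr0_norm.
Qed.

End dual_space.

(** Mazur-Orlicz below the norm, with [K] reduced to the point [y] and [a] its norm. *)
Lemma norming_functional (R : realType) (V : normedModType R) (y : V) :
  exists2 g : dual V, `|g| <= 1 & g y = `|y|.
Proof.
have [|f [lf f1 fy]] := mazur_orlicz (normr_sublinear V) (set1_convex (y := y))
  (a := `|y|).
  by move=> v ->.
have [|F FE] := @dual_of_bounded _ _ f 1 lf; first by move=> x; rewrite mul1r.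
exists F; last by apply/eqP; rewrite FE eq_le f1 fy.
apply: dual_norm_le => x x1; rewrite ler_norml lerNl -dualN !FE.
by rewrite !(le_trans (f1 _))// normrN.
Qed.

(** By reflexivity a bidual functional norming [f] is evaluation at some [y]; a functional norming
    [y] shows that [y] lies in the unit ball, and scaling by [|f|] gives the element sought. *)
Lemma duality_map_neq0 (R : realType) (X : normedModType R)
  (f : dual X) : reflexive_space X -> duality_map f !=set0.
Proof.
move=> rX; have [phi phi1 phif] := norming_functional f.
have [y yphi] := rX phi.
have fy : f y = `|f| by rewrite -yphi.
have y1 : `|y| <= 1.
  have [g g1 <-] := norming_functional y; rewrite -yphi.
  have := dual_norm_bound phi g; have := ler_norm (phi g).
  have : `|phi| * `|g| <= 1 by rewrite mulr_ile1.
  by lra.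
exists (`|f| *: y); split; first by rewrite dualZ fy expr2.
have [f0|f0] := eqVneq `|f| 0; first by rewrite f0 scale0r normr0.
have fp : 0 < `|f| by rewrite lt_def f0 normr_ge0.
have : `|f| <= `|f| * `|y|.
  by have := dual_norm_bound f y; rewrite fy normr_id.
rewrite ler_pMr// => y1'.
by rewrite normrZ normr_id (_ : `|y| = 1) ?mulr1//; lra.
Qed.

Section clarke.
Context {R : realType} {X : normedModType R}.
Variable J : X -> R.
Implicit Types (x y v w : X) (a e : R).

(** The limsup unfolded into a uniform bound near [x], multiplied by [t] to avoid quotients. *)
Definition clarke_bound x v a := exists2 d : R, 0 < d &
  forall y t, `|y - x| < d -> 0 < t < d -> J (y + t *: v) - J y <= t * a.

Lemma clarke_lt_bound x v a :
  (clarke_derivative J x v < a%:E)%E -> clarke_bound x v a.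
Proof.
move=> /ereal_inf_lt[_ [A [[B C] /= [xB C0] BCA] <-] Aa].
have /nbhs_ballP[d1 /= d10 B1] := xB.
have /nbhs_ballP[d2 /= d20 C2] := C0.
exists (Num.min d1 d2); first by rewrite lt_min d10.
move=> y t; rewrite !lt_min => /andP[yd1 _] /and3P[t0 _ td2].
rewrite -ler_pdivrMl// mulrC.
have : A (y, t).
  apply: BCA; split => /=.
    by apply: B1; rewrite -ball_normE /= distrC.
  by apply: C2 => //; rewrite -ball_normE /= sub0r normrN gtr0_norm.
move=> Ayt; rewrite -lee_fin; apply: le_trans (ltW Aa).
by apply: ereal_sup_ubound; exists (y, t).
Qed.

Lemma clarke_bound_le x v a :
  clarke_bound x v a -> (clarke_derivative J x v <= a%:E)%E.
Proof.
move=> [d d0 dP].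
apply: (@le_trans _ _ (ereal_sup ((fun p : X * R =>
    ((J (p.1 + p.2 *: v) - J p.1) / p.2)%:E) @`
    [set p | `|p.1 - x| < d /\ 0 < p.2 < d]))).
  apply: ereal_inf_lbound; eexists; last reflexivity.
  exists (ball x d, [set t | 0 < t < d]).
    split => /=; first exact: nbhsx_ballx.
    near=> t; apply/andP; split => //.
  move=> [y t] /= []; rewrite -ball_normE /= distrC => ? ?; split => //.
apply: ge_ereal_sup => _ [[y t] /= [yd td] <-].
rewrite lee_fin; have := dP _ _ yd td; case/andP: td => t0 _.
by rewrite ler_pdivrMr// mulrC.
Unshelve. all: by end_near. Qed.

Lemma clarke_ge x v a :
  (forall d : R, 0 < d -> exists y t, [/\ `|y - x| < d, 0 < t < d &
    t * a <= J (y + t *: v) - J y]) -> (a%:E <= clarke_derivative J x v)%E.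
Proof.
move=> H; apply: le_ereal_inf_tmp => _ [A [[B C] /= [xB C0] BCA] <-].
have /nbhs_ballP[d1 /= d10 B1] := xB.
have /nbhs_ballP[d2 /= d20 C2] := C0.
have [|y [t [yd td ta]]] := H (Num.min d1 d2); first by rewrite lt_min d10.
move: yd td; rewrite !lt_min => /andP[yd1 _] /and3P[t0 _ td2].
apply: (@le_trans _ _ ((J (y + t *: v) - J y) / t)%:E).
  by rewrite lee_fin ler_pdivlMr// mulrC.
apply: ereal_sup_ubound; exists (y, t) => //.
apply: BCA; split => /=.
  by apply: B1; rewrite -ball_normE /= distrC.
by apply: C2 => //; rewrite -ball_normE /= sub0r normrN gtr0_norm.
Qed.

Hypothesis lJ : locally_lipschitz J.

Lemma locally_lipschitzP x : exists2 L : R, 0 <= L & exists2 d : R, 0 < d &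
  forall y z, `|y - x| < d -> `|z - x| < d -> `|J y - J z| <= L * `|y - z|.
Proof.
have [U xU /pinfty_ex_gt0[L L0 lip]] := lJ x.
have /nbhs_ballP[d /= d0 dU] := xU.
exists L; first exact: ltW.
exists d => // y z yd zd; apply: (lip (y, z)).
by split => /=; apply: dU; rewrite -ball_normE /= distrC.
Qed.

Lemma locally_lipschitz_continuous : continuous J.
Proof.
move=> x; have [L L0 [d d0 lip]] := locally_lipschitzP x.
apply/cvgrPdist_lt => e e0.
have L1 : 0 < L + 1 by lra.
have m0 : 0 < Num.min d (e / (L + 1)) by rewrite lt_min d0 divr_gt0.
near=> y.
have : `|x - y| < Num.min d (e / (L + 1)).
  by near: y; apply/nbhs_ballP; exists (Num.min d (e / (L + 1))) => //= y; rewrite -ball_normE.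
rewrite lt_min => /andP[yd ye].
have := lip x y; rewrite subrr normr0 [`|y - x|]distrC => /(_ d0 yd) h.
rewrite ltr_pdivlMr// in ye.
have : 0 <= `|x - y| by [].
by nra.
Unshelve. all: by end_near. Qed.

Lemma clarke_bound_lipschitz x : exists2 L : R, 0 <= L & forall v,
  clarke_bound x v (L * `|v|) /\ ((- (L * `|v|))%:E <= clarke_derivative J x v)%E.
Proof.
have [L L0 [d d0 lip]] := locally_lipschitzP x.
exists L => // v.
have v1 : 0 < 1 + `|v| by have : 0 <= `|v| by []; lra.
(* Such steps move a point by less than [d / 2], so both endpoints stay in the ball where [J] is
   Lipschitz. *)
have hs y t (d' : R) : 0 < d' -> d' <= d / 2 / (1 + `|v|) -> `|y - x| < d / 2 -> 0 < t < d' ->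
    `|J (y + t *: v) - J y| <= t * (L * `|v|).
  move=> d'0 d'd yd /andP[t0 td].
  have tv : `|t *: v| < d / 2.
    rewrite normrZ gtr0_norm//.
    have : t < d / 2 / (1 + `|v|) by lra.
    by rewrite ltr_pdivlMr//; nra.
  have := lip (y + t *: v) y; rewrite [X in L * `|X|]addrAC subrr add0r.
  rewrite [in L * _]normrZ gtr0_norm// => h.
  rewrite mulrCA; apply: h; last by lra.
  by rewrite addrAC (le_lt_trans (ler_normD _ _))//; lra.
pose d' := Num.min (d / 2) (d / 2 / (1 + `|v|)).
have d'0 : 0 < d' by rewrite lt_min !divr_gt0.
have d'd : d' <= d / 2 by rewrite ge_min lexx.
have d'v : d' <= d / 2 / (1 + `|v|) by rewrite ge_min lexx orbT.
split.
  exists d' => // y t yd td.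
  apply: le_trans (ler_norm _) (hs _ _ _ d'0 d'v _ td); lra.
apply: clarke_ge => e e0.
have m0 : 0 < Num.min e d' by rewrite lt_min e0.
exists x, (Num.min e d' / 2).
have h1 : Num.min e d' <= e by rewrite ge_min lexx.
have h2 : Num.min e d' <= d' by rewrite ge_min lexx orbT.
rewrite subrr normr0; split=> //; first by apply/andP; split; lra.
have /= := hs x (Num.min e d' / 2) d' d'0 d'v.
rewrite subrr normr0 => /(_ ltac:(lra)) /(_ ltac:(apply/andP; split; lra)).
by rewrite ler_norml; lra.
Qed.

Lemma clarke_fin_num x v : clarke_derivative J x v \is a fin_num.
Proof.
have [L L0 /(_ v)[/clarke_bound_le h1 h2]] := clarke_bound_lipschitz x.
rewrite fin_numE; apply/andP; split; apply/eqP => E.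
  by rewrite E leeNy_eq in h2.
by rewrite E leye_eq in h1.
Qed.

Definition rclarke x v : R := fine (clarke_derivative J x v).

Lemma rclarkeE x v : clarke_derivative J x v = (rclarke x v)%:E.
Proof. by rewrite fineK// clarke_fin_num. Qed.

Lemma rclarke_bound x v e : 0 < e -> clarke_bound x v (rclarke x v + e).
Proof.
by move=> e0; apply: clarke_lt_bound; rewrite rclarkeE lte_fin ltrDl.
Qed.

Lemma rclarke_le x v a : clarke_bound x v a -> rclarke x v <= a.
Proof. by move=> /clarke_bound_le; rewrite rclarkeE lee_fin. Qed.

(** The increment along [v + w] splits at [y + t *: v], an admissible base point because base points
    may vary near [x]. Homogeneity is the substitution of [t * l] for [t]. *)
Lemma rclarke_sublinear x : sublinear (rclarke x).
Proof.
split=> [v w|l v l0].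
  apply/ler_addgt0Pr => e e0; have e2 : 0 < e / 2 by lra.
  have [d1 d10 H1] := rclarke_bound x v e2.
  have [d2 d20 H2] := rclarke_bound x w e2.
  apply: rclarke_le.
  have v1 : 0 < 1 + `|v| by have : 0 <= `|v| by []; lra.
  exists (Num.min d1 (Num.min (d2 / 2) (d2 / 2 / (1 + `|v|)))).
    by rewrite !lt_min d10 !divr_gt0.
  move=> y t; rewrite !lt_min => /and3P[y1 y2 _] /andP[t0 /and3P[t1 t2 t3]].
  have tv : `|t *: v| < d2 / 2.
    by rewrite normrZ gtr0_norm//; rewrite ltr_pdivlMr// in t3; nra.
  have := H1 y t y1; rewrite t0 t1 => /(_ isT).
  have yx : `|y + t *: v - x| < d2.
    by rewrite addrAC (le_lt_trans (ler_normD _ _))//; lra.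
  have := H2 _ t yx; rewrite t0 scalerDr addrA => /(_ ltac:(lra)).
  by lra.
apply/ler_addgt0Pr => e e0; have el : 0 < e / l by rewrite divr_gt0.
have [d d0 H] := rclarke_bound x v el.
apply: rclarke_le; exists (Num.min d (d / l)); first by rewrite lt_min d0 divr_gt0.
move=> y t; rewrite !lt_min => /andP[yd _] /and3P[t0 td tdl].
have := H y (t * l) yd; rewrite mulr_gt0//= -ltr_pdivlMr// tdl => /(_ isT).
rewrite scalerA; have -> : t * l * (rclarke x v + e / l) = t * (l * rclarke x v + e).
  by field; rewrite gt_eqF.
by [].
Qed.

(* The Mazur-Orlicz theorem replaces the usual minimax argument on the weak-star
   compact set of generalized gradients. *)
Lemma clarke_descent x (K : set X) (b c : R) : c < b ->
  (forall u v (l : R), K u -> K v -> 0 <= l <= 1 ->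
     K (l *: u + (1 - l) *: v)) ->
  (forall f, clarke_subdiff J x f -> exists2 u, K u & b <= f u) ->
  exists2 u, K u & (clarke_derivative J x (- u)%R < (- c)%:E)%E.
Proof.
move=> cb cK fK; apply: contrapT => nex.
(* If no [u] works, the derivative is at least [- c] on the reflected set; the functional obtained
   is a generalized gradient with [f u <= c] on [K], against [b <= f u] for some [u]. *)
have [||f [lf fq fc]] := @mazur_orlicz _ _ (rclarke x) [set v | K (- v)] (- c)
  (rclarke_sublinear x).
- move=> u v l /= Ku Kv l01; rewrite opprD -!scalerN; exact: cK.
- move=> v /= Kv; rewrite leNgt; apply/negP => vc; apply: nex.
  by exists (- v) => //; rewrite opprK rclarkeE lte_fin.
have [L L0 HL] := clarke_bound_lipschitz x.
have [z|F FE] := dual_of_bounded (L := L) lf.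
  by apply: le_trans (fq z) _; apply: rclarke_le; case: (HL z).
have [|u Ku bu] := fK F.
  by move=> v; rewrite FE rclarkeE lee_fin.
have := fc (- u); rewrite /= opprK => /(_ Ku).
by rewrite -FE dualN; lra.
Qed.

(** A bound on increments in a ball about [x] also holds in half that ball about each nearby [z n]:
    the Clarke derivative is upper semicontinuous in its base point, while [f n v] tends to 0. *)
Lemma clarke_subdiff_lim (z : nat -> X) (f : nat -> dual X) (x : X) :
  z @ \oo --> x -> `|f n| @[n --> \oo] --> (0 : R) ->
  (forall n, clarke_subdiff J (z n) (f n)) -> clarke_subdiff J x 0.
Proof.
move=> zx f0 Hf v; rewrite rclarkeE lee_fin -[(0 : dual X) v]/(0 : R).
apply/ler_addgt0Pr => e e0; have e2 : 0 < e / 2 by lra.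
have [d d0 H] := rclarke_bound x v e2.
have v1 : 0 < 1 + `|v| by have : 0 <= `|v| by []; lra.
have e3 : 0 < e / 2 / (1 + `|v|) by rewrite divr_gt0.
have d2 : 0 < d / 2 by lra.
have [N _ HN] : \forall n \near \oo, `|x - z n| < d / 2 /\ `|f n| < e / 2 / (1 + `|v|).
  apply: filterI; first by have /cvgrPdist_lt := zx; exact.
  have /cvgrPdist_lt/(_ _ e3) := f0; apply: filterS => n.
  by rewrite sub0r normrN normr_id.
have [zN fN] := HN N (leqnn N).
have : (f N v : R) <= rclarke x v + e / 2.
  have := Hf N v; rewrite rclarkeE lee_fin => /le_trans; apply.
  apply: rclarke_le; exists (d / 2) => // y t yz td; apply: H; last by lra.
  have := ler_normD (y - z N) (z N - x); rewrite addrA subrK.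
  by rewrite [`|z N - x|]distrC; lra.
have := dual_norm_bound (f N) v.
rewrite ltr_pdivlMr// in fN.
have : 0 <= `|f N| by []. have : 0 <= `|v| by [].
by rewrite ler_norml => ? ? /andP[]; nra.
Qed.

End clarke.

(** * Distance to a cone *)

Section limits.
Context {R : realType} {I : Type} (F : set_system I) {FF : Filter F}.
Implicit Types (f g : I -> R) (a b : R).

Lemma cvg_maxr f g a b : f @ F --> a -> g @ F --> b ->
  Num.max (f i) (g i) @[i --> F] --> Num.max a b.
Proof.
move=> fa gb; rewrite maxr_absE; under eq_fun do rewrite maxr_absE.
apply: cvgM; last exact: cvg_cst.
by apply: cvgD; [exact: cvgD|apply: cvg_norm; exact: cvgB].
Qed.

Lemma cvg_minr f g a b : f @ F --> a -> g @ F --> b ->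
  Num.min (f i) (g i) @[i --> F] --> Num.min a b.
Proof.
move=> fa gb; rewrite minr_absE; under eq_fun do rewrite minr_absE.
apply: cvgM; last exact: cvg_cst.
by apply: cvgB; [exact: cvgD|apply: cvg_norm; exact: cvgB].
Qed.

End limits.

Section cone_distance.
Context {R : realType} {X : normedModType R}.
Implicit Types (A P : set X) (x y : X).

Definition convex_cone A := [/\ A 0, forall x y, A x -> A y -> A (x + y) &
  forall x (l : R), A x -> 0 <= l -> A (l *: x)].

Definition cdist A x : R := inf [set `|x - a| | a in A].

Lemma cone_convex_cone P : cone P -> convex_cone P.
Proof.
move=> [_ cP ZP P0]; split => //.
- by have [] : (P `&` -%R @` P) 0 by rewrite P0.
- move=> x y Px Py.
  (* A sum is twice a midpoint, so convexity is used at the weight 1/2 only. *)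
  have h01 : Itv.spec (@Itv.num_sem R) (Itv.Real `[0%Z, 1%Z]) (2^-1 : R).
    by rewrite /= /Itv.num_sem num_real in_itv /=; apply/andP; split; lra.
  have := cP x y (Itv.mk h01); rewrite !inE => /(_ Px Py).
  rewrite -[conv _ _ _]/(2^-1 *: x + (1 - 2^-1) *: y) => Pxy.
  have := ZP _ 2 Pxy ltac:(lra).
  rewrite (_ : 1 - 2^-1 = 2^-1 :> R); last by lra.
  by rewrite -scalerDr scalerA divff// scale1r.
Qed.

Lemma convex_coneN A : convex_cone A -> convex_cone (-%R @` A).
Proof.
move=> [A0 AD AZ]; split; first by exists 0; rewrite ?oppr0.
- by move=> _ _ [x Ax <-] [y Ay <-]; exists (x + y); [exact: AD|rewrite opprD].
- by move=> _ l [x Ax <-] l0; exists (l *: x); [exact: AZ|rewrite scalerN].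
Qed.

Section convex_cone.
Variable A : set X.
Hypothesis cA : convex_cone A.

Let E x := [set `|x - a| | a in A].

Let Ehas x : has_inf (E x).
Proof.
split; first by exists `|x - 0|, 0 => //; case: cA.
by exists 0 => _ [a _ <-].
Qed.

Lemma cdist_ub x a : A a -> cdist A x <= `|x - a|.
Proof. by move=> Aa; apply: ge_inf; [case: (Ehas x)|exists a]. Qed.

Lemma cdist_le_norm x : cdist A x <= `|x|.
Proof. by have := @cdist_ub x 0; rewrite subr0; apply; case: cA. Qed.

Lemma cdist_sublinear : sublinear (cdist A).
Proof.
have [_ AD AZ] := cA; split=> [x y|l x l0].
  rewrite -lerBlDr; apply: lb_le_inf; first by case: (Ehas x).
  move=> _ [a Aa <-]; rewrite lerBlDr -lerBlDl.
  apply: lb_le_inf; first by case: (Ehas y).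
  move=> _ [b Ab <-]; rewrite lerBlDl.
  apply: le_trans (cdist_ub _ (AD _ _ Aa Ab)) _.
  by rewrite opprD addrACA ler_normD.
rewrite -ler_pdivrMl//; apply: lb_le_inf; first by case: (Ehas x).
move=> _ [a Aa <-]; rewrite ler_pdivrMl// -[X in X * _]gtr0_norm// -normrZ.
by rewrite scalerBr; apply: cdist_ub; apply: AZ => //; exact: ltW.
Qed.

Lemma edist_inf_cdist x : edist_inf A x = (cdist A x)%:E.
Proof.
apply/eqP; rewrite eq_le; apply/andP; split; last first.
  apply: le_ereal_inf_tmp => _ [a Aa <-].
  apply: le_ereal_inf_tmp => _ [r [r0]] /[swap] <-.
  rewrite -ball_normE/= => xar.
  by rewrite lee_fin (le_trans (cdist_ub _ Aa))// ltW.
apply/lee_addgt0Pr => e e0.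
have [_ [a Aa <-] ae] := inf_adherent e0 (Ehas x).
apply: (@le_trans _ _ (edist (x, a))).
  by apply: ereal_inf_lbound; exists a.
rewrite -EFinD; apply: edist_fin => /=.
  by apply: le_lt_trans ae.
by rewrite -ball_normE.
Qed.

End convex_cone.
End cone_distance.

(** * Sublinear gauges dominated by the norm *)

Section gauge.
Context {R : realType} {X : normedModType R}.
Variable p : X -> R.
Hypotheses (sp : sublinear p) (p_le : forall x, p x <= `|x|).

Lemma gauge_lip x y : p x <= p y + `|x - y|.
Proof.
by have := sp.1 y (x - y); rewrite addrC subrK => /le_trans; apply; rewrite lerD2l.
Qed.

Lemma gauge_continuous : continuous p.
Proof.
move=> x; apply/cvgrPdist_lt => e e0; near=> y.
have xy : `|x - y| < e.
  by near: y; apply/nbhs_ballP; exists e => //= y; rewrite -ball_normE.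
have := gauge_lip x y; have := gauge_lip y x; rewrite [`|y - x|]distrC.
by rewrite ltr_norml => ? ?; apply/andP; split; lra.
Unshelve. all: by end_near. Qed.

(** Stretching [x] by [1 + d / 2 / |x|] stays within distance [d] and raises the gauge above [mu],
    so [x] is not interior. *)
Lemma gauge_boundary (mu : R) x : 0 < mu -> p x = mu ->
  boundary [set y | p y <= mu] x.
Proof.
move=> mu0 pxmu; split; first by apply: subset_closure; rewrite /= pxmu.
move=> /nbhs_ballP[d /= d0 dD].
have x0 : 0 < `|x| by rewrite (lt_le_trans mu0)// -pxmu.
have dx0 : 0 < d / 2 / `|x| by rewrite !divr_gt0.
have : (ball x d) ((1 + d / 2 / `|x|) *: x).
  rewrite -ball_normE /= scalerDl scale1r opprD addrA subrr sub0r normrN normrZ.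
  by rewrite gtr0_norm// divfK ?gt_eqF//; lra.
move/dD; rewrite /= sublinearZ//; last by lra.
by rewrite pxmu; nra.
Qed.

End gauge.

(** * Linking *)

Section rel_boundary.
Context {R : realType} {X : normedModType R}.
Variable Q : set X.
Hypothesis clQ : closed Q.

Let H := closed_affine_hull Q.

Let QH : Q `<=` H. Proof. exact: sub_gen_smallest. Qed.

Let clH : closed H.
Proof. by apply: closed_bigI => A [[clA _] _]. Qed.

Lemma rel_boundary_sub : rel_boundary Q `<=` Q.
Proof.
have /closure_id {2}-> := clQ.
by move=> x [] + _; rewrite (closure_subspaceW QH) => -[].
Qed.

(** It is closed in the subspace topology of the affine hull, and the hull is itself closed. *)
Lemma closed_rel_boundary : closed (rel_boundary Q).
Proof.
have /setIidl <- : rel_boundary Q `<=` H.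
  exact: subset_trans rel_boundary_sub QH.
rewrite (closed_setIS (rel_boundary Q : set (subspace H)) clH).
rewrite /rel_boundary /boundary setDE; apply: closedI; first exact: closed_closure.
by apply: open_closedC; exact: open_interior.
Qed.

End rel_boundary.

Section linking.
Context {R : realType} {X : normedModType R}.
Variables (d : X -> R) (mu : R).
Hypotheses (dc : continuous d) (mu0 : 0 < mu).
Hypothesis dZ : forall (l : R) x, 0 <= l -> d (l *: x) = l * d x.
Implicit Types (x y a b : X) (s t : R).

(** Radial retraction onto the sublevel set of [d] at level [s]. *)
Definition radial s y : X := (s / Num.max s (d y)) *: y.

Lemma radial_id s y : 0 < s -> d y <= s -> radial s y = y.
Proof. by move=> s0 /max_l dy; rewrite /radial dy divff ?gt_eqF// scale1r. Qed.

Lemma radial_le s y : 0 < s -> d (radial s y) <= s.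
Proof.
move=> s0; have m0 : 0 < Num.max s (d y) by rewrite lt_max s0.
rewrite dZ; last by rewrite divr_ge0// ltW.
rewrite -mulrA ger_pMr//.
by rewrite ler_pdivrMl// mulr1 le_max lexx orbT.
Qed.

(** The segment from [a] to [b], retracted at a level that leaves both ends fixed; this level is
    [mu] when both ends lie in the sublevel set. *)
Definition radial_homotopy a b t :=
  radial (Num.max mu (Num.max (d a) (d b))) ((1 - t) *: a + t *: b).

Let lvl_gt0 a b : 0 < Num.max mu (Num.max (d a) (d b)).
Proof. by rewrite lt_max mu0. Qed.

Lemma radial_homotopy0 a b : radial_homotopy a b 0 = a.
Proof.
rewrite /radial_homotopy subr0 scale1r scale0r addr0 radial_id//.
by rewrite !le_max lexx orbT.
Qed.

Lemma radial_homotopy1 a b : radial_homotopy a b 1 = b.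
Proof.
rewrite /radial_homotopy subrr scale1r scale0r add0r radial_id//.
by rewrite !le_max lexx !orbT.
Qed.

Lemma radial_homotopyxx a t : radial_homotopy a a t = a.
Proof.
rewrite /radial_homotopy -scalerDl subrK scale1r radial_id//.
by rewrite !le_max lexx !orbT.
Qed.

Lemma radial_homotopy_le a b t : d a <= mu -> d b <= mu ->
  d (radial_homotopy a b t) <= mu.
Proof.
move=> da db; apply: le_trans (radial_le _ (lvl_gt0 _ _)) _.
by rewrite !ge_max lexx da.
Qed.

Lemma radial_homotopy_cvg (I : Type) (F : set_system I) (FF : Filter F)
    (f g : I -> X) (h : I -> R) a b t :
  f @ F --> a -> g @ F --> b -> h @ F --> t ->
  radial_homotopy (f i) (g i) (h i) @[i --> F] --> radial_homotopy a b t.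
Proof.
move=> fa gb ht; rewrite /radial_homotopy /radial.
have dcv (k : I -> X) c : k @ F --> c -> d (k i) @[i --> F] --> d c.
  by move=> kc; apply: continuous_cvg => //; exact: dc.
have cv1 : ((1 - h i) *: f i + h i *: g i) @[i --> F] -->
    (1 - t) *: a + t *: b.
  apply: cvgD; apply: cvgZ => //; apply: cvgB => //; exact: cvg_cst.
have cv2 : Num.max mu (Num.max (d (f i)) (d (g i))) @[i --> F] -->
    Num.max mu (Num.max (d a) (d b)).
  by apply: cvg_maxr; [exact: cvg_cst|apply: cvg_maxr; exact: dcv].
apply: cvgZ => //; apply: cvgM => //; apply: cvgV.
  by rewrite gt_eqF// lt_max lvl_gt0.
by apply: cvg_maxr => //; exact: dcv.
Qed.

(* The radial homotopy moves a map of Gamma to the identity; on the relative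
   boundary it never meets T, so it can be damped to 0 where it does. *)
Lemma Gamma_meets_linked (Q T : set X) (gamma : X -> X) : compact Q ->
  linking Q T -> T `<=` [set x | mu < d x] ->
  Gamma Q [set x | d x <= mu] gamma -> gamma @` Q `&` T !=set0.
Proof.
move=> cQ [clQ clT QT link] TW [gc gid gW].
pose H x t := radial_homotopy (gamma x) x t.
have sQ := rel_boundary_sub clQ.
(* The points of [Q] whose trajectory hits [T] at some time. *)
pose K := [set x | Q x /\ exists2 t, `[0, 1]%classic t & T (H x t)].
have Hcvg x t (I : Type) (F : set_system I) (FF : Filter F) (g : I -> X) (h : I -> R) :
    Q x -> g @ F --> within Q (nbhs x) -> h @ F --> t ->
    H (g i) (h i) @[i --> F] --> H x t.
  move=> Qx gx ht; apply: radial_homotopy_cvg => //.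
    by have /subspace_continuousP/(_ x Qx) := gc; apply: cvg_comp.
  by apply: cvg_trans gx _; exact: cvg_within.
have clK : closed K.
  rewrite -openC openE => x nKx; rewrite /interior.
  have [Qx|nQx] := pselect (Q x); last first.
    have : nbhs x (~` Q) by apply: open_nbhs_nbhs; split => //; exact: closed_openC.
    by apply: filterS => y nQy [].
  (* Tube argument: since [0,1] is compact and [T] closed, trajectories near one that avoids [T]
     avoid it at all times. *)
  have : \forall y \near within Q (nbhs x), `[0, 1]%classic `<=` (fun t => ~ T (H y t)).
    have /compact_near_coveringP seg := @segment_compact R 0 1.
    apply: (seg X (within Q (nbhs x)) (fun y t => ~ T (H y t))) => t t01.
    have nT : (~` T) (H x t) by move=> Tx; apply: nKx; split=> //; exists t.
    have : nbhs (H x t) (~` T) by apply: open_nbhs_nbhs; split => //; exact: closed_openC.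
    have hc := @Hcvg x t (R * X)%type (filter_prod (nbhs t) (within Q (nbhs x))) _
      snd fst Qx cvg_snd cvg_fst.
    by move/hc.
  rewrite near_withinE; apply: filterS => y Hy [Qy [t t01]].
  exact: Hy.
(* Over a boundary point of [W] the trajectory stays in [W], which misses [T]; over any other
   boundary point it is constant, and linking separates the boundary from [T]. *)
have KE : K `&` rel_boundary Q = set0.
  rewrite -subset0 => x [[Qx [t t01 Tt]] Ex].
  have [Wx|nWx] := pselect (d x <= mu).
    have := TW _ Tt; rewrite /= ltNge => /negP; apply.
    by apply: radial_homotopy_le => //; apply: gW; exists x.
  have Tx : T x by move: Tt; rewrite /H gid// radial_homotopyxx.
  by have : (rel_boundary Q `&` T) x by []; rewrite QT.
have sep : uniform_separator K (rel_boundary Q).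
  have := @pseudometric_normal R X => /(@normal_separatorP R X).
  by apply => //; exact: closed_rel_boundary.
pose phi : X -> R := Urysohn K (rel_boundary Q).
have phi1 x : rel_boundary Q x -> phi x = 1.
  by move=> Ex; apply: (Urysohn_sub1 sep); exists x.
have phi0 x : K x -> phi x = 0.
  by move=> Kx; apply: (Urysohn_sub0 sep); exists x.
have phi01 x : `[0, 1]%classic (phi x).
  have /(_ (phi x)) := @Urysohn_range X R K (rel_boundary Q).
  by apply; exists x.
(* The damped map is the identity on the boundary, where [phi] is 1. A point it sends into [T] lies
   in [K], where [phi] is 0 and the map is [gamma]. *)
have [|x Ex|_ [[x Qx <-] Tx]] := link (fun x => H x (phi x)).
- apply/subspace_continuousP => x Qx; apply: Hcvg => //.
  apply: cvg_within_filter; exact: Urysohn_continuous.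
- by rewrite /H phi1// radial_homotopy1.
- exists (gamma x); split; first by exists x.
  have Kx : K x by split => //; exists (phi x).
  by move: Tx; rewrite phi0// /H radial_homotopy0.
Qed.

End linking.

(** * Descent directions *)

Section directions.
Context {R : realType} {X : normedModType R}.
Variable p : X -> R.
Hypothesis sp : sublinear p.
Implicit Types (z u v : X) (s t mu : R).

Lemma sublinear_shrink z u s t mu : 0 < s -> p z <= mu -> p (z - s *: u) < mu ->
  0 < t <= s -> p (z - t *: u) < mu.
Proof.
move=> s0 pz ps /andP[t0 ts].
have ts0 : 0 < t / s by rewrite divr_gt0.
have ts1 : 0 <= 1 - t / s by rewrite subr_ge0 ler_pdivrMr// mul1r.
have -> : z - t *: u = (1 - t / s) *: z + (t / s) *: (z - s *: u).
  by rewrite scalerBr scalerA divfK ?gt_eqF// addrA -scalerDl subrK scale1r.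
apply: le_lt_trans (sp.1 _ _) _.
by rewrite (sublinearZ _ sp ts1) (sublinearZ _ sp (ltW ts0)); nra.
Qed.

(** The step [Num.min s t] serves both directions, and convexity of [p] does the rest. This makes
    the set of admissible directions convex, as [clarke_descent] requires. *)
Lemma sublinear_inward_convex z mu u v (l : R) : p z <= mu -> 0 <= l <= 1 ->
  (exists2 s : R, 0 < s & p (z - s *: u) < mu) ->
  (exists2 s : R, 0 < s & p (z - s *: v) < mu) ->
  exists2 s : R, 0 < s & p (z - s *: (l *: u + (1 - l) *: v)) < mu.
Proof.
move=> pz /andP[l0 l1] [s s0 ps] [t t0 pt].
have m0 : 0 < Num.min s t by rewrite lt_min s0.
exists (Num.min s t) => //; set m := Num.min s t in m0 *.
have ps' : p (z - m *: u) < mu.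
  by apply: (sublinear_shrink s0 pz ps); rewrite m0 ge_min lexx.
have pt' : p (z - m *: v) < mu.
  by apply: (sublinear_shrink t0 pz pt); rewrite m0 ge_min lexx orbT.
have -> : z - m *: (l *: u + (1 - l) *: v) =
    l *: (z - m *: u) + (1 - l) *: (z - m *: v).
  rewrite !scalerBr !scalerDr addrACA -scalerDl (addrC l) subrK scale1r.
  by rewrite -opprD !scalerA !(mulrC m).
have l1' : 0 <= 1 - l by lra.
apply: le_lt_trans (sp.1 _ _) _.
rewrite (sublinearZ _ sp l0) (sublinearZ _ sp l1').
move: l0; rewrite le_eqVlt => /predU1P[<-|l0]; last by nra.
by rewrite mul0r add0r subr0 mul1r.
Qed.

(** The missing weight is put on [z] itself, which makes the point a convex combination of points of
    the sublevel set. *)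
Lemma sublinear_combination (I : eqType) (l : seq I) (xi : I -> R) (u : I -> X)
    z t mu : p z <= mu -> (forall i, 0 <= xi i) -> \sum_(i <- l) xi i <= 1 ->
  (forall i, i \in l -> 0 < xi i -> p (z - t *: u i) <= mu) ->
  p (z - t *: \sum_(i <- l) xi i *: u i) <= mu.
Proof.
move=> pz xi0 xi1 Hl.
have key : p ((\sum_(i <- l) xi i) *: z - t *: \sum_(i <- l) xi i *: u i) <=
    (\sum_(i <- l) xi i) * mu.
  elim: l {xi1} Hl => [|i l ih] Hl.
    by rewrite !big_nil scale0r scaler0 subr0 mul0r sublinear0.
  rewrite !big_cons.
  have -> : (xi i + \sum_(j <- l) xi j) *: z -
      t *: (xi i *: u i + \sum_(j <- l) xi j *: u j) =
      xi i *: (z - t *: u i) +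
      ((\sum_(j <- l) xi j) *: z - t *: \sum_(j <- l) xi j *: u j).
    rewrite scalerDl scalerDr opprD addrACA scalerBr.
    by rewrite !scalerA (mulrC t).
  apply: le_trans (sp.1 _ _) _; rewrite mulrDl; apply: lerD; last first.
    by apply: ih => j jl; apply: Hl; rewrite in_cons jl orbT.
  rewrite sublinearZ//; have := xi0 i; rewrite le_eqVlt => /predU1P[<-|x0].
    by rewrite !mul0r.
  by rewrite ler_pM2l//; apply: Hl => //; rewrite in_cons eqxx.
set c := \sum_(i <- l) xi i in xi1 key *.
have -> : z - t *: \sum_(i <- l) xi i *: u i =
    (1 - c) *: z + (c *: z - t *: \sum_(i <- l) xi i *: u i).
  by rewrite addrA -scalerDl subrK scale1r.
have c1 : 0 <= 1 - c by lra.
apply: le_trans (sp.1 _ _) _; rewrite (sublinearZ _ sp c1); nra.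
Qed.

End directions.

Section weighted_sums.
Context {R : realType} {X : normedModType R} {I : eqType}.
Variables (xi : I -> R) (u : I -> X).
Hypothesis xi0 : forall i, 0 <= xi i.
Implicit Types (l : seq I).

Lemma weighted_sum_norm l (w : R) :
  (forall i, i \in l -> 0 < xi i -> `|u i| <= w) ->
  `|\sum_(i <- l) xi i *: u i| <= (\sum_(i <- l) xi i) * w.
Proof.
elim: l => [|i l ih] Hl; first by rewrite !big_nil normr0 mul0r.
rewrite !big_cons (le_trans (ler_normD _ _))// mulrDl lerD//; last first.
  by apply: ih => j jl; apply: Hl; rewrite in_cons jl orbT.
rewrite normrZ ger0_norm//; have := xi0 i; rewrite le_eqVlt => /predU1P[<-|x0].
  by rewrite !mul0r.
by rewrite ler_pM2l//; apply: Hl => //; rewrite in_cons eqxx.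
Qed.

Lemma weighted_sum_norm1 l : (forall i, i \in l -> xi i <= 1) ->
  `|\sum_(i <- l) xi i *: u i| <= \sum_(i <- l) `|u i|.
Proof.
elim: l => [|i l ih] Hl; first by rewrite !big_nil normr0.
rewrite !big_cons (le_trans (ler_normD _ _))// lerD//; last first.
  by apply: ih => j jl; apply: Hl; rewrite in_cons jl orbT.
by rewrite normrZ ger0_norm// ler_piMl// Hl// in_cons eqxx.
Qed.

(* Telescoping: the coordinates are perturbed one after the other, so that no
   convexity of the Clarke derivative is needed. *)
Lemma weighted_sum_descent (J : X -> R) l (y : X) (s t e : R) :
  0 < t -> t < s -> t * \sum_(i <- l) `|u i| < s ->
  (forall i, i \in l -> xi i <= 1) ->
  (forall i, i \in l -> 0 < xi i -> forall y' tau, `|y' - y| < s ->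
     0 < tau < s -> J (y' - tau *: u i) - J y' <= - e * tau) ->
  J (y - t *: \sum_(i <- l) xi i *: u i) <= J y - e * t * \sum_(i <- l) xi i.
Proof.
move=> t0 ts; elim: l => [|i l ih] ls l1 lJ.
  by rewrite !big_nil scaler0 subr0 mulr0 subr0.
have ls' : t * \sum_(j <- l) `|u j| < s.
  apply: le_lt_trans ls; rewrite ler_pM2l// big_cons lerDr//.
have l1' j : j \in l -> xi j <= 1 by move=> jl; apply: l1; rewrite in_cons jl orbT.
have {}ih := ih ls' l1' (fun j jl => lJ j (@mem_behead _ (i :: l) j jl)).
rewrite !big_cons scalerDr opprD (addrC (- _)) addrA.
set y' := y - _ in ih *.
have [xi00|xi00] := eqVneq (xi i) 0.
  by rewrite xi00 scale0r scaler0 subr0 add0r.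
have xip : 0 < xi i by rewrite lt_def xi00 xi0.
have i1 : xi i <= 1 by apply: l1; rewrite in_cons eqxx.
have yy' : `|y' - y| < s.
  rewrite /y' addrAC subrr sub0r normrN normrZ gtr0_norm//.
  by apply: le_lt_trans ls'; rewrite ler_pM2l//; exact: weighted_sum_norm1.
have := lJ i (mem_head _ _) xip y' (t * xi i) yy'.
rewrite mulr_gt0//= scalerA => /(_ _) h.
have : t * xi i < s by nra.
by move/h; lra.
Qed.

End weighted_sums.

Section descent_direction.
Context {R : realType} {X : normedModType R} {B : Type}.
Variables (J : X -> R) (e : B -> X -> R) (mu : R).
Hypotheses (rX : reflexive_space X) (lJ : locally_lipschitz J).
Hypotheses (es : forall b, sublinear (e b)) (mu0 : 0 < mu).
Hypothesis ha : forall b x y, e b x = mu -> grad J x y -> e b (x - y) <= mu / 2.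

Lemma exists_descent_direction z (w m c : R) : 0 < w -> 0 < m -> c < w * m ->
  (forall f, clarke_subdiff J z f -> m <= `|f|) ->
  exists u, [/\ `|u| <= w, (clarke_derivative J z (- u)%R < (- c)%:E)%E &
    forall b, e b z = mu -> exists2 s : R, 0 < s & e b (z - s *: u) < mu].
Proof.
move=> w0 m0 cwm Hm.
pose K := [set u : X | `|u| <= w /\
  forall b, e b z = mu -> exists2 s : R, 0 < s & e b (z - s *: u) < mu].
have [||u [uw Hu] uc] := clarke_descent lJ (x := z) (K := K) cwm; last first.
- by exists u; split.
- move=> f Jf; have fm := Hm f Jf.
  have [y fy] := duality_map_neq0 f rX; have [fy1 fy2] := fy.
  have fyn : `|y| = `|f| by apply/eqP; rewrite -(@eqrXn2 _ 2)// fy2.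
  have f0 : 0 < `|f| by lra.
  (* The dual element [y] rescaled to length [w] has [f]-value [w * |f|]. The step [|f| / w] undoes
     the scaling and lands at [z - y], where [ha] gives level [mu / 2]. *)
  exists ((w / `|f|) *: y); last first.
    by rewrite dualZ fy1 expr2 mulrA divfK ?gt_eqF// ler_pM2l.
  split.
    by rewrite normrZ gtr0_norm ?divr_gt0// fyn divfK ?gt_eqF.
  move=> b eb; exists (`|f| / w); first by rewrite divr_gt0.
  rewrite scalerA mulrA divfK ?gt_eqF// divff ?gt_eqF// scale1r.
  apply: (@le_lt_trans _ _ (mu / 2)); last by move: mu0; lra.
  by apply: ha => //; exists f.
- move=> u v l [uw Hu] [vw Hv] l01; split; last first.
    move=> b eb; apply: sublinear_inward_convex => //; rewrite ?eb//.
      exact: Hu.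
    exact: Hv.
  case/andP: l01 => l0 l1.
  rewrite (le_trans (ler_normD _ _))// !normrZ !ger0_norm//; last by lra.
  by nra.
Qed.

End descent_direction.

(** * Perturbation *)

Lemma cvg_sum_seq (R : realType) (V : normedModType R) (T : Type)
    (F : set_system T) (FF : Filter F) (I : Type) (l : seq I)
    (f : I -> T -> V) (a : I -> V) :
  (forall i, f i @ F --> a i) ->
  \sum_(i <- l) f i x @[x --> F] --> \sum_(i <- l) a i.
Proof.
move=> fa; elim: l => [|i l ih].
  by rewrite big_nil; under eq_fun do rewrite big_nil; exact: cvg_cst.
rewrite big_cons; under eq_fun do rewrite big_cons.
by apply: cvgD => //; exact: fa.
Qed.

Lemma seq_pos_lb (R : realType) (I : eqType) (l : seq I) (s : I -> R) :
  (forall i, i \in l -> 0 < s i) ->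
  exists2 m : R, 0 < m & forall i, i \in l -> m <= s i.
Proof.
elim: l => [|i l ih] sl; first by exists 1.
have [|m m0 ml] := ih; first by move=> j jl; apply: sl; rewrite in_cons jl orbT.
exists (Num.min m (s i)); first by rewrite lt_min m0 sl// in_cons eqxx.
move=> j; rewrite in_cons => /predU1P[->|jl]; first by rewrite ge_min lexx orbT.
by rewrite ge_min ml.
Qed.

Lemma finite_partition_of_unity (R : realType) (X : normedModType R) (B : set X)
    (rho : X -> R) : compact B -> (forall i, B i -> 0 < rho i) ->
  exists (l : seq X) (xi : X -> X -> R),
    [/\ [/\ forall i, i \in l -> B i, forall i x, 0 <= xi i x &
            forall i, continuous (xi i)],
        forall x, \sum_(i <- l) xi i x <= 1,
        forall x, B x -> \sum_(i <- l) xi i x = 1 &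
        forall i x, i \in l -> 0 < xi i x -> `|x - i| < rho i].
Proof.
move=> cB rho0; move: (cB); rewrite compact_cover.
move=> /(_ X B (fun i => ball i (rho i / 2)))[].
- by move=> i _; exact: ball_open.
- by move=> x Bx; exists x => //; apply: ballxx; rewrite divr_gt0// rho0.
move=> D DB cov; pose l : seq X := finmap.enum_fset D.
have lB i : i \in l -> B i by move=> il; have := DB i il; rewrite inE.
(* A tent at least 1 on the half ball and 0 off the full ball. The half balls cover [B], so the sum
   is at least 1 there; dividing by its maximum with 1 gives total 1 on [B] and stays continuous
   everywhere. *)
pose b (i x : X) : R := Num.max 0 (2 - 2 * `|x - i| / rho i).
have b0 i x : 0 <= b i x by rewrite le_max lexx.
pose N x : R := Num.max 1 (\sum_(i <- l) b i x).
have N0 x : 0 < N x by rewrite lt_max ltr01.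
have bc i : continuous (b i).
  move=> x; apply: cvg_maxr; first exact: cvg_cst.
  apply: cvgB; first exact: cvg_cst.
  apply: cvgM; last exact: cvg_cst.
  apply: cvgM; first exact: cvg_cst.
  by apply: cvg_norm; apply: cvgB => //; exact: cvg_cst.
exists l, (fun i x => b i x / N x); split.
- split=> // [i x|i x]; first by rewrite divr_ge0// ltW.
  apply: cvgM; first exact: bc.
  apply: cvgV; first by rewrite gt_eqF.
  apply: cvg_maxr; first exact: cvg_cst.
  by apply: (@cvg_sum_seq R R^o) => i'; exact: bc.
- by move=> x; rewrite -mulr_suml ler_pdivrMr// mul1r le_max lexx orbT.
- move=> x Bx; rewrite -mulr_suml.
  have [i Di xi] := cov x Bx.
  have il : i \in l by [].
  have b1 : 1 <= b i x.
    move: xi; rewrite -ball_normE /= distrC => xi.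
    rewrite le_max; apply/orP; right.
    have r0 := rho0 _ (lB _ il).
    have : 2 * `|x - i| / rho i <= 1 by rewrite ler_pdivrMr//; lra.
    by lra.
  have s1 : 1 <= \sum_(j <- l) b j x.
    rewrite (perm_big _ (perm_to_rem il)) big_cons (le_trans b1)// lerDl.
    by apply: sumr_ge0.
  by rewrite /N max_r// divff// gt_eqF//; lra.
- move=> i x il; rewrite pmulr_lgt0 ?invr_gt0// /b lt_max ltxx /=.
  have r0 := rho0 _ (lB _ il).
  by rewrite subr_gt0 ltr_pdivrMr// ltr_pM2l.
Qed.

Section perturbation.
Context {R : realType} {X : normedModType R}.
Variables (J : X -> R) (e : bool -> X -> R) (mu : R).
Hypothesis lJ : locally_lipschitz J.
Hypotheses (es : forall b, sublinear (e b)) (el : forall b x, e b x <= `|x|).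
Variables (Q : set X) (gamma : X -> X) (w : X -> R).
Hypotheses (cQ : compact Q) (gc : {within Q, continuous gamma}).
Hypotheses (wc : {within Q, continuous (w : X -> R^o)}) (w0 : forall x, 0 < w x).
Variables (eps alpha : R).
Hypotheses (eps0 : 0 < eps).

(** One direction serving a whole neighbourhood in [Q]. The clause on [alpha] keeps the perturbation
    off the points at low level, where elements of [Gamma] are prescribed. *)
Definition descent_patch x (u : X) (rho s : R) := forall x', Q x' ->
  `|x' - x| < rho -> [/\ `|u| <= 2 * w x', alpha < J (gamma x'),
    forall y (tau : R), `|y - gamma x'| < s -> 0 < tau < s ->
      J (y - tau *: u) - J y <= - (2 * eps) * tau &
    forall b, e b (gamma x') <= mu -> forall tau : R, 0 < tau <= s ->
      e b (gamma x' - tau *: u) <= mu].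

Definition descent_direction_at x (u : X) := [/\ `|u| <= w x,
  (clarke_derivative J (gamma x) (- u)%R < (- (2 * eps))%:E)%E &
  forall b, e b (gamma x) = mu -> exists2 s : R, 0 < s & e b (gamma x - s *: u) < mu].

Lemma exists_descent_patch x u : Q x -> (forall b, mu <= e b (gamma x)) ->
  alpha < J (gamma x) -> descent_direction_at x u ->
  exists rho s, [/\ 0 < rho, 0 < s & descent_patch x u rho s].
Proof.
move=> Qx mue alJ [uw uc ub].
have gx : gamma @ within Q (nbhs x) --> gamma x.
  by have /subspace_continuousP := gc; exact.
have wx : (w : X -> R^o) @ within Q (nbhs x) --> w x.
  by have /subspace_continuousP := wc; exact.
have ecv b v : e b (gamma y - v) @[y --> within Q (nbhs x)] --> e b (gamma x - v).
  apply: continuous_cvg; first exact: gauge_continuous (es b) (el b) _.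
  by apply: cvgB => //; exact: cvg_cst.
(* At level [mu] the inward step [s] persists nearby by continuity, and shorter steps follow by
   convexity. Above level [mu] nearby points are outside too, and the claim is vacuous. *)
have side b : exists2 s : R, 0 < s & \forall x' \near within Q (nbhs x),
    e b (gamma x') <= mu -> forall tau : R, 0 < tau <= s ->
      e b (gamma x' - tau *: u) <= mu.
  have := mue b; rewrite le_eqVlt => /predU1P[/esym eb|eb].
    have [s s0 sb] := ub b eb; exists s => //.
    near=> x' => ex' tau taus; apply: ltW.
    apply: (sublinear_shrink (es b) s0) => //.
    by near: x'; apply: (cvgr_lt _ (ecv b (s *: u))).
  exists 1 => //; have /cvgr_gt/(_ mu) := ecv b 0; rewrite subr0 => /(_ eb).
  by apply: filterS => y; rewrite subr0 leNgt => ->.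
have [s1 s10 h1] := side true; have [s2 s20 h2] := side false.
have [d d0 Hd] := clarke_lt_bound uc.
pose s := Num.min (d / 2) (Num.min s1 s2).
have s0 : 0 < s by rewrite !lt_min divr_gt0// s10.
have sd : s <= d / 2 by rewrite ge_min lexx.
have ss1 : s <= s1 by rewrite !ge_min lexx !orbT.
have ss2 : s <= s2 by rewrite !ge_min lexx !orbT.
have d20 : 0 < d / 2 by lra.
have : \forall x' \near within Q (nbhs x), [/\ `|u| <= 2 * w x', alpha < J (gamma x'),
    forall y (tau : R), `|y - gamma x'| < s -> 0 < tau < s ->
      J (y - tau *: u) - J y <= - (2 * eps) * tau &
    forall b, e b (gamma x') <= mu -> forall tau : R, 0 < tau <= s ->
      e b (gamma x' - tau *: u) <= mu].
  near=> x'; split.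
  - have : w x / 2 < w x'.
      near: x'; apply: (cvgr_gt _ wx); have := w0 x; lra.
    by lra.
  - near: x'; apply: (cvgr_gt (J (gamma x))) => //.
    apply: continuous_cvg => //; exact: locally_lipschitz_continuous.
  - move=> y tau ys /andP[tau0 taus].
    have gg : `|gamma x - gamma x'| < d / 2.
      by near: x'; have /cvgrPdist_lt := gx; exact.
    have := Hd y tau; rewrite scalerN mulrC; apply; last by lra.
    have := ler_normD (y - gamma x') (gamma x' - gamma x).
    by rewrite addrA subrK [`|gamma x' - gamma x|]distrC; lra.
  - move=> [] eb tau /andP[tau0 taus].
      have h : e true (gamma x') <= mu -> forall tau : R, 0 < tau <= s1 ->
        e true (gamma x' - tau *: u) <= mu by near: x'.
      by apply: h => //; rewrite tau0 (le_trans taus).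
    have h : e false (gamma x') <= mu -> forall tau : R, 0 < tau <= s2 ->
      e false (gamma x' - tau *: u) <= mu by near: x'.
    by apply: h => //; rewrite tau0 (le_trans taus).
rewrite near_withinE => /nbhs_ballP[rho /= rho0 H].
exists rho, s; split => // x' Qx' xx'; apply: H => //.
by rewrite -ball_normE /= distrC.
Unshelve. all: by end_near. Qed.

Lemma compact_within_preimage (C : set X) : closed C ->
  compact [set x | Q x /\ C (gamma x)].
Proof.
move=> clC; have clQ : closed Q by apply: compact_closed => //; exact: norm_hausdorff.
apply: (subclosed_compact _ cQ); last by move=> x [].
have /continuous_closedP/(_ _ clC) := gc; rewrite -(closed_setIS _ clQ).
by congr closed; apply/seteqP; split => x [].
Qed.

(** Descent patches over the compact set of points in the band [[c - kappa, c]] are glued by a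
    partition of unity, and [gamma] is moved by a small common time [t]. *)
Lemma exists_perturbation (c kappa : R) : 0 < kappa -> alpha < c - kappa ->
  (forall x, Q x -> (forall b, mu < e b (gamma x)) -> J (gamma x) <= c) ->
  (forall x, Q x -> (forall b, mu <= e b (gamma x)) ->
     c - kappa <= J (gamma x) <= c -> exists u, descent_direction_at x u) ->
  exists (g : X -> X) (t : R), [/\ 0 < t, {within Q, continuous g},
    forall x, Q x -> `|g x - gamma x| <= 2 * t * w x,
    forall x, Q x -> J (gamma x) <= alpha -> g x = gamma x &
    (forall x b, Q x -> e b (gamma x) <= mu -> e b (g x) <= mu) /\
    (forall x, Q x -> (forall b, mu < e b (g x)) -> J (g x) <= c - 2 * eps * t)].
Proof.
move=> k0 ack Jc dir.
pose C := [set y | (forall b, mu <= e b y) /\ c - kappa <= J y <= c].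
pose B := [set x | Q x /\ C (gamma x)].
have clC : closed C.
  have ce b : closed [set y | mu <= e b y].
    have /continuous_closedP/(_ [set a | mu <= a]) :=
      gauge_continuous (es b) (el b).
    by apply; exact: closed_ge.
  have /continuous_closedP cJ := locally_lipschitz_continuous lJ.
  have -> : C = ([set y | mu <= e true y] `&` [set y | mu <= e false y]) `&`
      (J @^-1` [set a | c - kappa <= a] `&` J @^-1` [set a | a <= c]).
    apply/seteqP; split=> y.
      by move=> [ye /andP[J1 J2]]; split; split=> //; exact: ye.
    by move=> [[y1 y2] [J1 J2]]; split; [case|apply/andP].
  apply: closedI; apply: closedI => //; apply: cJ.
    exact: closed_ge.
  exact: closed_le.
have cB : compact B by exact: compact_within_preimage.
have /choice[D HD] x : exists D : X * (R * R), B x ->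
    [/\ 0 < D.2.1, 0 < D.2.2 & descent_patch x D.1 D.2.1 D.2.2].
  have [[Qx [xe /andP[J1 J2]]]|nB] := pselect (B x); last by exists (0, (0, 0)).
  have [|u ux] := dir x Qx xe; first by rewrite J1.
  have [|rho [s H]] := exists_descent_patch Qx xe _ ux; first by lra.
  by exists (u, (rho, s)).
have [|l [xi [[lB xi0 xic] xi1 xiB xid]]] :=
  @finite_partition_of_unity R X B (fun i => (D i).2.1) cB.
  by move=> i /HD[].
pose u i := (D i).1.
have [|s s0 sl] := @seq_pos_lb R X l (fun i => (D i).2.2).
  by move=> i /lB/HD[].
have patch x i : Q x -> i \in l -> 0 < xi i x -> [/\ `|u i| <= 2 * w x,
    alpha < J (gamma x),
    forall y (tau : R), `|y - gamma x| < s -> 0 < tau < s ->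
      J (y - tau *: u i) - J y <= - (2 * eps) * tau &
    forall b, e b (gamma x) <= mu -> forall tau : R, 0 < tau <= s ->
      e b (gamma x - tau *: u i) <= mu].
  move=> Qx il xip; have [_ _ /(_ x Qx (xid _ _ il xip))[h1 h2 h3 h4]] := HD i (lB i il).
  have ss := sl i il; split=> //.
    move=> y tau ys /andP[tau0 taus]; apply: h3; first exact: lt_le_trans ss.
    by rewrite tau0 (lt_le_trans taus).
  move=> b eb tau /andP[tau0 taus]; apply: h4 => //.
  by rewrite tau0 (le_trans taus).
have xile1 x i : i \in l -> xi i x <= 1.
  move=> il; apply: le_trans (xi1 x).
  rewrite (perm_big _ (perm_to_rem il)) big_cons lerDl.
  by apply: sumr_ge0.
pose M := \sum_(i <- l) `|u i|.
have M0 : 0 <= M by apply: sumr_ge0.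
(* The first bound keeps every telescoping point within [s], as [M] dominates all partial sums; the
   second keeps the drop [2 * eps * t] within the band width [kappa]. *)
pose t := Num.min (s / 2 / (1 + M)) (kappa / (2 * eps)).
have M1 : 0 < 1 + M by rewrite ltr_pwDl.
have t0 : 0 < t.
  rewrite lt_min; apply/andP; split; first by rewrite !divr_gt0.
  by rewrite divr_gt0// mulr_gt0.
have tM : t * (1 + M) <= s / 2 by rewrite -ler_pdivlMr// ge_min lexx.
have ts : t < s by nra.
have tMs : t * M < s by nra.
have tk : 2 * eps * t <= kappa.
  rewrite mulrC -ler_pdivlMr; last by rewrite mulr_gt0.
  by rewrite ge_min lexx orbT.
pose g x := gamma x - t *: \sum_(i <- l) xi i x *: u i.
have inv x b : Q x -> e b (gamma x) <= mu -> e b (g x) <= mu.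
  move=> Qx eb; apply: sublinear_combination => // i il xip.
  have [_ _ _] := patch x i Qx il xip; apply => //.
  by rewrite t0 ltW.
exists g, t; split => //.
- apply/subspace_continuousP => x Qx; apply: cvgB.
    by have /subspace_continuousP := gc; exact.
  apply: cvgZ; first exact: cvg_cst.
  apply: cvg_sum_seq => i; apply: cvgZ; last exact: cvg_cst.
  by apply: cvg_within_filter; exact: xic.
- move=> x Qx; rewrite /g addrAC subrr sub0r normrN normrZ gtr0_norm//.
  rewrite (mulrC 2) -mulrA ler_pM2l//.
  apply: (le_trans (weighted_sum_norm (w := 2 * w x) (xi0^~ x) _)).
    by move=> i il xip; have [] := patch x i Qx il xip.
  have := w0 x; have := xi1 x; nra.
- move=> x Qx Ja; rewrite /g big_seq big1 ?scaler0 ?subr0// => i il.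
  have [->|xin] := eqVneq (xi i x) 0; first by rewrite scale0r.
  have xip : 0 < xi i x by rewrite lt_def xin xi0.
  by have [_ + _ _] := patch x i Qx il xip; rewrite ltNge Ja.
split => // x Qx gS.
have gS' b : mu < e b (gamma x).
  by rewrite ltNge; apply/negP => /(inv x b Qx); rewrite leNgt gS.
have Jx := Jc x Qx gS'.
have desc : J (g x) <= J (gamma x) - 2 * eps * t * \sum_(i <- l) xi i x.
  apply: (weighted_sum_descent (xi0^~ x) t0 ts tMs (xile1 x)) => i il xip.
  by have [] := patch x i Qx il xip.
(* On [B] the weights total 1 and the full drop is gained; off [B] the value is already below
   [c - kappa] and does not increase. *)
have [Bx|nBx] := pselect (B x); first by move: desc; rewrite xiB//; lra.
have Jk : J (gamma x) < c - kappa.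
  rewrite ltNge; apply/negP => Jk; apply: nBx; split=> //; split.
    by move=> b; exact: ltW.
  by rewrite Jk.
have sxi : 0 <= \sum_(i <- l) xi i x by apply: sumr_ge0.
have : 0 <= 2 * eps * t * \sum_(i <- l) xi i x by rewrite !mulr_ge0// ltW.
lra.
Qed.

End perturbation.

(** * Minimax value *)

Section minimax_value.
Context {R : realType} {X : completeNormedModType R}.
Variables (J : X -> R) (e : bool -> X -> R) (mu : R).
Hypothesis lJ : locally_lipschitz J.
Hypotheses (es : forall b, sublinear (e b)) (el : forall b x, e b x <= `|x|).
Variable Q : set X.
Hypotheses (cQ : compact Q).

Let W : set X := [set x | exists b, e b x <= mu].

Let clQ : closed Q.
Proof. by apply: compact_closed => //; exact: norm_hausdorff. Qed.

Lemma gauge_unionC x : (~` W) x <-> forall b, mu < e b x.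
Proof.
split=> [nW b|h [b]]; last by rewrite leNgt h.
by rewrite ltNge; apply/negP => eb; apply: nW; exists b.
Qed.

Lemma closed_gauge_union : closed W.
Proof.
have ce b : closed [set y | e b y <= mu].
  have /continuous_closedP/(_ [set a | a <= mu]) :=
    gauge_continuous (es b) (el b).
  by apply; exact: closed_le.
have -> : W = [set y | e true y <= mu] `|` [set y | e false y <= mu].
  apply/seteqP; split=> y; first by move=> [[] ?]; [left|right].
  by move=> [?|?]; [exists true|exists false].
exact: closedU.
Qed.

(** Real counterpart of the supremum inside [minimax]. On [Gamma] it is a genuine supremum: the set
    is nonempty by [GammaS] and bounded by compactness of [Q]. *)
Definition max_value (gamma : X -> X) : R :=
  sup [set J x | x in gamma @` Q `&` ~` W].

Hypothesis GammaS : forall gamma, Gamma Q W gamma ->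
  gamma @` Q `&` ~` W !=set0.

Lemma max_value_has_sup gamma : Gamma Q W gamma ->
  has_sup [set J x | x in gamma @` Q `&` ~` W].
Proof.
move=> Gg; have [gc _ _] := Gg; split.
  by have [y ?] := GammaS Gg; exists (J y), y.
have cI : compact (gamma @` Q) by exact: continuous_compact.
have : compact (J @` (gamma @` Q) : set R^o).
  apply: continuous_compact => //; apply: continuous_subspaceT.
  exact: locally_lipschitz_continuous.
move=> /compact_bounded/pinfty_ex_gt0[M M0 HM].
exists M => _ [y [yQ _] <-]; apply: le_trans (ler_norm _) _.
by apply: HM; exists y.
Qed.

Lemma max_value_ub gamma x : Gamma Q W gamma -> Q x -> (~` W) (gamma x) ->
  J (gamma x) <= max_value gamma.
Proof.
move=> Gg Qx nW; apply: ub_le_sup; first by case: (max_value_has_sup Gg).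
by exists (gamma x) => //; split=> //; exists x.
Qed.

Lemma max_value_le gamma a : Gamma Q W gamma ->
  (forall x, Q x -> (~` W) (gamma x) -> J (gamma x) <= a) ->
  max_value gamma <= a.
Proof.
move=> Gg Ha; apply: ge_sup; first by case: (max_value_has_sup Gg).
by move=> _ [_ [[x Qx <-] nW] <-]; exact: Ha.
Qed.

Lemma ereal_sup_max_value gamma : Gamma Q W gamma ->
  ereal_sup [set (J x)%:E | x in gamma @` Q `&` ~` W] = (max_value gamma)%:E.
Proof.
move=> Gg; have [[y0 hy0] hub] := max_value_has_sup Gg.
apply/eqP; rewrite eq_le; apply/andP; split.
  apply: ge_ereal_sup => _ [y hy <-]; rewrite lee_fin.
  by apply: ub_le_sup => //; exists y.
apply/lee_addgt0Pr => d d0.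
have [_ [y hy <-] yd] := sup_adherent d0 (max_value_has_sup Gg).
apply: (@le_trans _ _ ((J y)%:E + d%:E)%E).
  by rewrite -EFinD lee_fin -lerBlDr ltW.
by apply: leeD2r; apply: ereal_sup_ubound; exists y.
Qed.

Variables (w : X -> R) (M eps rho : R).
Hypotheses (w0 : forall x, 0 < w x) (wM : forall x, Q x -> w x <= M).
Hypotheses (eps0 : 0 < eps).
Hypothesis rho_le : forall gamma, Gamma Q W gamma -> rho <= max_value gamma.

(** The values decrease to a limit [a], so [u] is uniformly Cauchy on [Q]. Closedness of [W] passes
    the boundary condition to the limit [g]; openness of its complement puts [u m y] outside [W]
    eventually when [g y] is, whence [max_value g <= a]. *)
Lemma Gamma_chain_lb (u : nat -> X -> X) : (forall n, Gamma Q W (u n)) ->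
  (forall n, max_value (u n.+1) <= max_value (u n)) ->
  (forall n m x, (n <= m)%N -> Q x -> eps * `|u m x - u n x| <=
    w x * (max_value (u n) - max_value (u m))) ->
  exists2 g, Gamma Q W g & forall n x, Q x -> eps * `|g x - u n x| <=
    w x * (max_value (u n) - max_value g).
Proof.
move=> Gu dec ulip; pose v n := max_value (u n).
have vdec : nonincreasing_seq v by apply/nonincreasing_seqP.
have vlb : has_lbound (range v) by exists rho => _ [n _ <-]; exact: rho_le.
have vcvg := nonincreasing_cvgn vdec vlb.
set a := inf _ in vcvg.
have av n : a <= v n by apply: ge_inf => //; exists n.
have ulip' n m x : (n <= m)%N -> Q x -> eps * `|u m x - u n x| <= w x * (v n - a).
  move=> nm Qx; apply: le_trans (ulip _ _ _ nm Qx) _.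
  by rewrite ler_pM2l// lerD2l lerN2; exact: av.
have small d : 0 < d -> exists N, M * (v N - a) < d * eps.
  move=> d0; have [M0|M0] := leP M 0.
    exists 0%N; apply: (@le_lt_trans _ _ 0); last by rewrite mulr_gt0.
    by rewrite mulr_le0_ge0// subr_ge0.
  have dM : 0 < d * eps / M by rewrite divr_gt0// mulr_gt0.
  have /cvgrPdist_lt/(_ _ dM)[N _ /(_ N (leqnn N))] := vcvg.
  rewrite distrC ger0_norm ?subr_ge0// => h; exists N.
  by rewrite ltr_pdivlMr// in h; rewrite mulrC.
have small' d : 0 < d -> exists N, forall n x, (N <= n)%N -> Q x ->
    w x * (v n - a) < d * eps.
  move=> d0; have [N HN] := small d d0; exists N => n x Nn Qx.
  apply: le_lt_trans HN; apply: (@le_trans _ _ (w x * (v N - a))).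
    by rewrite ler_pM2l// lerD2r; exact: vdec.
  by rewrite ler_wpM2r ?wM// subr_ge0.
pose g x : X := lim (u n x @[n --> \oo]).
have gcvg x : Q x -> u n x @[n --> \oo] --> g x.
  move=> Qx; suff : cvg (u n x @[n --> \oo]) by [].
  apply/cauchy_cvgP/cauchy_exP => d d0.
  have [N HN] := small' d d0; exists (u N x).
  exists N => // n /= Nn; rewrite -ball_normE /= distrC.
  have := ulip' N n x Nn Qx => /le_lt_trans/(_ (HN N x (leqnn N) Qx)).
  by rewrite mulrC ltr_pM2r.
have glip n x : Q x -> eps * `|g x - u n x| <= w x * (v n - a).
  move=> Qx; apply: (@closed_cvg _ _ \oo _ (fun m => eps * `|u m x - u n x|)
    (fun y => y <= w x * (v n - a))).
  - exact: closed_le.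
  - by exists n => // m /= nm; exact: ulip'.
  - apply: cvgM; first exact: cvg_cst.
    by apply: cvg_norm; apply: cvgB; [exact: gcvg|exact: cvg_cst].
have sQ := rel_boundary_sub clQ.
have Gg : Gamma Q W g.
  split.
  - apply/subspace_continuousP => x Qx; apply/cvgrPdist_lt => d d0.
    have d3 : 0 < d / 3 by lra.
    have [N HN] := small' _ d3.
    have gN y : Q y -> `|g y - u N y| < d / 3.
      move=> Qy; have := le_lt_trans (glip N y Qy) (HN N y (leqnn N) Qy).
      by rewrite mulrC ltr_pM2r.
    have [/subspace_continuousP/(_ x Qx)/cvgrPdist_lt/(_ _ d3) ucx _ _] := Gu N.
    near=> y.
    have Qy : Q y by near: y; exact: withinT.
    have uxy : `|u N x - u N y| < d / 3 by near: y.
    have := gN x Qx; have := gN y Qy; rewrite [`|g y - _|]distrC.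
    have := ler_distD (u N x) (g x) (g y).
    have := ler_distD (u N y) (u N x) (g y).
    by lra.
  - move=> x [Ex nWx]; apply: cvg_lim; first exact: norm_hausdorff.
    have uE n : u n x = x by have [_ h _] := Gu n; exact: h.
    by under eq_fun do rewrite uE; exact: cvg_cst.
  - move=> _ [x [Ex Wx] <-].
    apply: (@closed_cvg _ _ \oo _ (fun n => u n x) W closed_gauge_union).
      by apply: nearW => n; have [_ _ h] := Gu n; apply: h; exists x.
    by apply: gcvg; exact: sQ.
exists g => // n x Qx; apply: le_trans (glip n x Qx) _.
rewrite ler_pM2l// lerD2l lerN2.
apply: max_value_le => // y Qy nWy.
have : J (u m y) - v m @[m --> \oo] --> J (g y) - a.
  apply: cvgB => //; apply: continuous_cvg; last exact: gcvg.
  exact: locally_lipschitz_continuous.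
move=> Jv; rewrite -subr_le0.
apply: (@closed_cvg _ _ \oo _ (fun m => J (u m y) - v m)
    (fun c => c <= 0) (@closed_le _ 0) _ _ Jv).
have nWg : nbhs (g y) (~` W).
  by apply: open_nbhs_nbhs; split => //; apply: closed_openC; exact: closed_gauge_union.
have unW : \forall m \near \oo, (~` W) (u m y) := gcvg y Qy _ nWg.
near=> m; rewrite subr_le0; apply: max_value_ub => //.
by near: m.
Unshelve. all: by end_near. Qed.

End minimax_value.

(** * Almost critical points near the minimax level *)

Section almost_critical.
Context {R : realType} {X : completeNormedModType R}.
Variables (J : X -> R) (e : bool -> X -> R) (mu : R).
Hypotheses (rX : reflexive_space X) (lJ : locally_lipschitz J).
Hypotheses (es : forall b, sublinear (e b)) (el : forall b x, e b x <= `|x|).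
Hypothesis mu0 : 0 < mu.
Hypothesis ha : forall b x y, e b x = mu -> grad J x y -> e b (x - y) <= mu / 2.
Variable Q : set X.
Hypothesis cQ : compact Q.

Let W : set X := [set x | exists b, e b x <= mu].
Let psi := max_value J e mu Q.

Hypothesis GammaS : forall gamma, Gamma Q W gamma ->
  gamma @` Q `&` ~` W !=set0.
Variables (rho alpha : R).
Hypothesis rho_le : forall gamma, Gamma Q W gamma -> rho <= psi gamma.
Hypothesis rho_lt : forall d : R, 0 < d ->
  exists2 gamma, Gamma Q W gamma & psi gamma < rho + d.
Hypothesis alpha_rho : alpha < rho.
Hypothesis Jalpha : forall x, (rel_boundary Q `&` ~` W) x -> J x <= alpha.

(* The order weights displacements by 1 + |gamma0 x|, where gamma0 is nearly
   optimal: this produces the factor 1 + |z| of the Cerami condition without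
   changing the metric of X. *)
Lemma exists_almost_critical (eps : R) : 0 < eps -> exists z f,
  [/\ forall b, mu <= e b z, `|J z - rho| <= eps, clarke_subdiff J z f &
      (1 + `|z|) * `|f| <= 6 * eps].
Proof.
move=> eps0; apply: contrapT => none.
have e2 : 0 < eps / 2 by lra.
have [g0 Gg0 g0rho] := rho_lt e2.
pose w x : R := 1 + `|g0 x|.
have w0 x : 0 < w x by rewrite ltr_pwDl.
have clQ : closed Q by apply: compact_closed => //; exact: norm_hausdorff.
have g0c : {within Q, continuous g0} by case: Gg0.
have wc : {within Q, continuous (w : X -> R^o)}.
  apply/subspace_continuousP => x Qx; apply: cvgD; first exact: cvg_cst.
  by apply: cvg_norm; have /subspace_continuousP := g0c; exact.
have [M wM] : exists M, forall x, Q x -> w x <= M.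
  have : compact ((w : X -> R^o) @` Q) by exact: continuous_compact.
  move=> /compact_bounded/pinfty_ex_gt0[M M0 HM]; exists M => x Qx.
  by apply: le_trans (ler_norm _) _; apply: HM; exists x.
(* The order lives on all maps; its first clause carries membership in [Gamma] downwards from
   [g0]. *)
pose le (g' g : X -> X) := (Gamma Q W g -> Gamma Q W g') /\
  forall x, Q x -> eps * `|g' x - g x| <= w x * (psi g - psi g').
have [x0 Qx0] : Q !=set0 by have [_ [[x Qx _] _]] := GammaS Gg0; exists x.
have ordxx g : le g g.
  by split=> // x Qx; rewrite !subrr normr0 !mulr0.
have letr g1 g2 g3 : le g1 g2 -> le g2 g3 -> le g1 g3.
  move=> [G12 h12] [G23 h23]; split; first by move/G23/G12.
  move=> x Qx; have := h12 x Qx; have := h23 x Qx.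
  have := ler_distD (g2 x) (g1 x) (g3 x); have := w0 x; nra.
have lepsi g1 g2 : le g1 g2 -> psi g1 <= psi g2.
  move=> [_ /(_ x0 Qx0)] h; rewrite -subr_ge0 -(pmulr_rge0 _ (w0 x0)).
  by apply: le_trans h; rewrite mulr_ge0// ltW.
have [|u ug0 udec|g1 g10 g1min] := exists_order_minimal (x0 := g0) (b := rho)
  ordxx letr lepsi.
- by move=> g [Gg _]; apply: rho_le; exact: Gg.
- have ule n m : (n <= m)%N -> le (u m) (u n).
    elim: m => [|m ih]; first by rewrite leqn0 => /eqP ->.
    rewrite leq_eqVlt ltnS => /predU1P[->//|/ih]; exact: letr (udec m).
  have Gu n : Gamma Q W (u n).
    by have [+ _] := letr _ _ _ (ule 0%N n (leq0n n)) ug0; exact.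
  have [||g Gg gu] := @Gamma_chain_lb R X J e mu lJ es el Q cQ GammaS w M eps rho
    w0 wM eps0 rho_le u Gu.
  + by move=> n; apply: lepsi; exact: udec.
  + by move=> n m x nm Qx; have [_ ] := ule n m nm; exact.
  + by exists g => n; split => // x Qx; exact: gu.
have Gg1 : Gamma Q W g1 by have [+ _] := g10; exact.
have rho1 := rho_le Gg1.
have psi10 := lepsi _ _ g10.
(* The band below [psi g1] then stays within [eps] of [rho] and above [alpha]. *)
pose kappa := Num.min eps ((rho - alpha) / 2).
have k0 : 0 < kappa by rewrite lt_min eps0/= divr_gt0// subr_gt0.
have ke : kappa <= eps by rewrite ge_min lexx.
have ka : kappa <= (rho - alpha) / 2 by rewrite ge_min lexx orbT.
have [g1c g1id g1W] := Gg1.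
have [|||g [t [t0 gc gd gid [ginv gJ]]]] :=
  @exists_perturbation R X J e mu lJ es el Q g1 w cQ g1c wc w0 eps alpha eps0
    (psi g1) kappa k0.
- by lra.
- by move=> x Qx /gauge_unionC nW; exact: max_value_ub.
- move=> x Qx xe /andP[J1 J2].
  (* From [g0] to [g1] the value drops by less than [eps / 2], since it never goes below [rho]. *)
  have g1g0 : `|g1 x - g0 x| <= w x / 2.
    have [_ /(_ x Qx)] := g10; have := w0 x => w0x h.
    have : eps * `|g1 x - g0 x| <= eps * (w x / 2) by nra.
    by rewrite ler_pM2l.
  have zw : 1 + `|g1 x| <= 3 / 2 * w x.
    have := ler_normD (g1 x - g0 x) (g0 x); rewrite subrK.
    by move: g1g0; rewrite /w; lra.
  have z0 : 0 < 1 + `|g1 x| by rewrite ltr_pwDl.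
  (* A smaller subgradient would contradict [none]. As [1 + |g1 x| <= 3 / 2 * w x], the product
     [w x * m] is at least [4 * eps], more than the required [2 * eps]. *)
  apply: (exists_descent_direction rX lJ es mu0 ha (m := 6 * eps / (1 + `|g1 x|))).
  + exact: w0.
  + by rewrite divr_gt0// mulr_gt0.
  + by rewrite mulrA ltr_pdivlMr//; have := w0 x; nra.
  + move=> f Jf; rewrite leNgt; apply/negP => fm; apply: none.
    exists (g1 x), f; split => //.
      by rewrite ler_norml; apply/andP; split; lra.
    by rewrite mulrC ltW// -ltr_pdivlMr.
have Gg : Gamma Q W g.
  have sQ := rel_boundary_sub clQ.
  split=> // [x [Ex nWx]|_ [x [Ex Wx] <-]].
    rewrite gid ?g1id//; first exact: sQ.
    exact: Jalpha.
  have [b eb] : W (g1 x) by apply: g1W; exists x.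
  by exists b; apply: ginv => //; exact: sQ.
have psig : psi g <= psi g1 - 2 * eps * t.
  by apply: max_value_le => // x Qx /gauge_unionC; exact: gJ.
(* The displacement [2 * t * w x], multiplied by [eps], is covered by the drop [2 * eps * t]
   weighted by [w x]; minimality of [g1] then fails. *)
have : le g g1.
  split=> // x Qx; have := gd x Qx; have := w0 x; nra.
move/g1min; have : 0 < 2 * eps * t by rewrite !mulr_gt0.
by lra.
Qed.

End almost_critical.

(** * Passage to the limit *)

Lemma increasing_seq_ge (phi : nat -> nat) n : increasing_seq phi -> (n <= phi n)%N.
Proof.
move=> /increasing_seqP iphi; elim: n => // n ih.
exact: leq_ltn_trans ih (iphi n).
Qed.

(** The competitor [y = x] gives the lower bound, and the restriction to the unit ball about [x] the
    upper one. *)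
Lemma mD_setT_bounds (R : realType) (X : normedModType R) (J : X -> R) x f :
  clarke_subdiff J x f -> (0 <= mD J setT x <= `|f|%:E)%E.
Proof.
move=> Jf; apply/andP; split.
  apply: le_ereal_inf_tmp => _ [g _ <-].
  apply: ereal_sup_ubound; exists x; first by rewrite /= subrr normr0.
  by rewrite subrr dual0.
apply: (@le_trans _ _ (ereal_sup [set (f (x - y) : R)%:E | y in
    [set y | setT y /\ `|x - y| < 1]])).
  by apply: ereal_inf_lbound; exists f.
apply: ge_ereal_sup => _ [y [_ xy] <-]; rewrite lee_fin.
apply: le_trans (ler_norm _) _; apply: le_trans (dual_norm_bound _ _) _.
by rewrite ler_piMr// ltW.
Qed.

Theorem theorem3p1 (R : realType) (X : completeNormedModType R)
  (hX : reflexive_space X)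
  (P : set X) (hP : cone P)
  (J : X -> R) (hJ : locally_lipschitz J)
  (mu0 : R) (hmu0 : 0 < mu0 < 1)
  (ha_pos : id_minus_grad J (boundary (Dpos P mu0)) `<=` Dpos P (mu0 / 2))
  (ha_neg : id_minus_grad J (boundary (Dneg P mu0)) `<=` Dneg P (mu0 / 2))
  (hb_X : C_condition J setT setT)
  (hb_pos : C_condition J (Dpos P (3 / 4 * mu0)) (Dpos P mu0))
  (hb_neg : C_condition J (Dneg P (3 / 4 * mu0)) (Dneg P mu0))
  (hb_cap : C_condition J (Dpos P mu0 `&` Dneg P mu0) setT)
  (W S : set X) (hW : W = Dpos P mu0 `|` Dneg P mu0) (hS : S = ~` W)
  (Q T : set X) (hlink : linking Q T) (hT : T `<=` ~` W) (hQ : compact Q)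
  (hGamma : forall gamma, Gamma Q W gamma -> gamma @` Q `&` S !=set0)
  (alpha beta : R) (hab : alpha < beta)
  (hsup : (ereal_sup [set (J x)%:E | x in rel_boundary Q `&` S] <= alpha%:E)%E)
  (hinf : (beta%:E <= ereal_inf [set (J x)%:E | x in T])%E)
  (hJQ : (ereal_sup [set (J x)%:E | x in Q] < +oo)%E)
  (r : \bar R) (hr : r = minimax J Q W) :
  [/\ (beta%:E <= r)%E,
      critical_set J r `&` S !=set0 &
      exists x : X, [/\ ~ W x, clarke_subdiff J x 0 & (J x)%:E = r]].
Proof.
have /andP[mu_gt0 _] := hmu0.
pose e (b : bool) := cdist (if b then P else -%R @` P).
have cP b : convex_cone (if b then P else -%R @` P).
  have cP := cone_convex_cone hP.
  by case: b => //; exact: convex_coneN.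
have es b : sublinear (e b) by exact: cdist_sublinear.
have el b x : e b x <= `|x| by exact: cdist_le_norm.
have Dp mu : Dpos P mu = [set x | e true x <= mu].
  apply/seteqP; split => x; rewrite /Dpos /= (edist_inf_cdist (cP true)) lee_fin//.
have Dn mu : Dneg P mu = [set x | e false x <= mu].
  apply/seteqP; split => x; rewrite /Dneg /= (edist_inf_cdist (cP false)) lee_fin//.
(* Points at level [mu0] are boundary points, so (a) takes this form for both cones at once. *)
have ha b x y : e b x = mu0 -> grad J x y -> e b (x - y) <= mu0 / 2.
  move=> ex gxy; have := gauge_boundary (es b) (el b) mu_gt0 ex.
  case: b ex => ex bx.
    have := ha_pos (x - y); rewrite !Dp; apply.
    by exists x => //; exists y.
  have := ha_neg (x - y); rewrite !Dn; apply.
  by exists x => //; exists y.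
have {hW}hW : W = [set x | exists b, e b x <= mu0].
  rewrite hW Dp Dn; apply/seteqP; split=> x.
    by move=> [?|?]; [exists true|exists false].
  by move=> [[] ?]; [left|right].
rewrite hS {hS} in hGamma hsup *; rewrite hW in hGamma hsup hT hr *.
set V := [set x | exists b, e b x <= mu0] in hGamma hsup hT hr *.
have alphaE x : (rel_boundary Q `&` ~` V) x -> J x <= alpha.
  move=> Ex; rewrite -lee_fin; apply: le_trans hsup.
  by apply: ereal_sup_ubound; exists x.
(* A minimum of two distances is continuous and positively homogeneous, as the radial homotopy
   requires, and turns the union [V] into one sublevel set. *)
pose d x := Num.min (e true x) (e false x).
have VE : V = [set x | d x <= mu0].
  apply/seteqP; split=> x; rewrite /= /d ge_min.
    by move=> [[] ->]; rewrite ?orbT.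
  by move=> /orP[?|?]; [exists true|exists false].
have dc : continuous d.
  move=> x; apply: cvg_minr; exact: (gauge_continuous (es _) (el _)).
have dZ (l : R) x : 0 <= l -> d (l *: x) = l * d x.
  by move=> l0; rewrite /d !(sublinearZ _ (es _) l0) minr_pMr.
have meets gamma : Gamma Q V gamma -> gamma @` Q `&` T !=set0.
  rewrite VE; apply: (Gamma_meets_linked dc mu_gt0 dZ) => // x /hT.
  by rewrite VE /= => /negP; rewrite -ltNge.
pose psi := max_value J e mu0 Q.
have beta_psi gamma : Gamma Q V gamma -> beta <= psi gamma.
  move=> Gg; have [_ [[x Qx <-] Tx]] := meets _ Gg.
  apply: (@le_trans _ _ (J (gamma x))).
    rewrite -lee_fin; apply: le_trans hinf _.
    by apply: ereal_inf_lbound; exists (gamma x).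
  by apply: max_value_ub => //; exact: hT.
have rE : r = ereal_inf [set (psi gamma)%:E | gamma in Gamma Q V].
  rewrite hr /minimax; congr ereal_inf; apply/seteqP; split=> _ [g Gg <-].
    by exists g => //; rewrite ereal_sup_max_value.
  by exists g => //; rewrite ereal_sup_max_value.
have beta_r : (beta%:E <= r)%E.
  rewrite rE; apply: le_ereal_inf_tmp => _ [g Gg <-].
  by rewrite lee_fin; exact: beta_psi.
have Gid : Gamma Q V id.
  split=> //; last by move=> _ [x [_ Vx] <-].
  by apply: continuous_subspaceT => x; exact: cvg_id.
(* Linking bounds [r] below by [beta], and the identity, a member of [Gamma], bounds it above. *)
have r_fin : r \is a fin_num.
  have rid : (r <= (psi id)%:E)%E.
    by rewrite rE; apply: ereal_inf_lbound; exists id.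
  rewrite fin_numE; apply/andP; split; apply/eqP => rinf.
    by rewrite rinf leeNy_eq in beta_r.
  by rewrite rinf leye_eq in rid.
pose rho := fine r.
have rrho : r = rho%:E by rewrite fineK.
have rho_le gamma : Gamma Q V gamma -> rho <= psi gamma.
  move=> Gg; rewrite -lee_fin -rrho rE; apply: ereal_inf_lbound.
  by exists gamma.
have rho_lt (h : R) : 0 < h -> exists2 gamma, Gamma Q V gamma & psi gamma < rho + h.
  move=> h0; have : (r < (rho + h)%:E)%E by rewrite rrho lte_fin ltrDl.
  rewrite {1}rE => /ereal_inf_lt[_ [g Gg <-]]; rewrite lte_fin => gh.
  by exists g.
have alpha_rho : alpha < rho.
  by apply: lt_le_trans hab _; rewrite -lee_fin -rrho.
have /choice[zf zfP] n : exists zf : X * dual X,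
    [/\ forall b, mu0 <= e b zf.1, `|J zf.1 - rho| <= harmonic n,
        clarke_subdiff J zf.1 zf.2 &
        (1 + `|zf.1|) * `|zf.2| <= 6 * harmonic n].
  have [z [f H]] := exists_almost_critical hX hJ es el mu_gt0 ha hQ hGamma
    rho_le rho_lt alpha_rho alphaE (harmonic_gt0 n).
  by exists (z, f).
pose z n := (zf n).1; pose f n := (zf n).2.
have Jrho : J (z n) @[n --> \oo] --> rho.
  apply/cvgrPdist_le => h h0.
  have /cvgrPdist_le/(_ h h0) := @cvg_harmonic R.
  apply: filterS => n; rewrite sub0r normrN distrC => hn.
  have [_ + _ _] := zfP n => /le_trans; apply.
  exact: le_trans (ler_norm _) hn.
have h6 : (6 * harmonic n : R) @[n --> \oo] --> (0 : R).
  by rewrite -[X in _ --> X](mulr0 6); apply: cvgM; [exact: cvg_cst|exact: cvg_harmonic].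
have [phi iphi /cvg_ex[x zx]] :
    exists2 phi : nat -> nat, increasing_seq phi & cvgn (z \o phi).
  apply: hb_X => //; first by exists rho.
  (* [mD] over the whole space is at most the norm of any subgradient, so the weighted estimate on
     [f n] supplies the C-condition. *)
  apply: (@squeeze_cvge _ _ _ _ (cst 0%E) _ (fun n => (6 * harmonic n)%:E)).
  - apply: nearW => n; have [_ _ Jf fb] := zfP n.
    have /andP[m0 mf] := mD_setT_bounds Jf.
    apply/andP; split; first by rewrite mule_ge0// lee_fin addr_ge0.
    apply: (@le_trans _ _ ((1 + `|z n|)%:E * `|f n|%:E)%E).
      by apply: lee_wpmul2l => //; rewrite lee_fin addr_ge0.
    by rewrite -EFinM lee_fin.
  - exact: cvg_cst.
  - by apply: cvg_EFin; [exact: nearW|exact: h6].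
have phige n := increasing_seq_ge n iphi.
have phicvg : phi n @[n --> \oo] --> \oo.
  move=> A [N _ NA]; exists N => // n /= Nn; apply: NA => /=.
  exact: leq_trans Nn (phige n).
have Jx : J x = rho.
  apply: (@cvg_unique _ _ (J (z (phi n)) @[n --> \oo])).
  - exact: norm_hausdorff.
  - apply: continuous_cvg => //; exact: locally_lipschitz_continuous.
  - exact: (cvg_comp phi (J \o z) phicvg Jrho).
have mux b : mu0 <= e b x.
  apply: (@closed_cvg _ _ \oo _ (fun n => e b (z (phi n)))
    (fun c => mu0 <= c) (@closed_ge _ mu0)).
    by apply: nearW => n; have [+ _ _ _] := zfP (phi n); exact.
  apply: continuous_cvg => //; exact: (gauge_continuous (es b) (el b)).
have crit : clarke_subdiff J x 0.
  apply: (@clarke_subdiff_lim _ _ J hJ (z \o phi) (f \o phi)) => //; last first.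
    by move=> n; have [] := zfP (phi n).
  apply: (@squeeze_cvgr _ _ _ _ (cst 0) (fun n => 6 * harmonic (phi n))).
  - apply: nearW => n; rewrite normr_ge0 /=.
    have [_ _ _] := zfP (phi n); apply: le_trans.
    by rewrite ler_peMl// lerDl.
  - exact: cvg_cst.
  - exact: (cvg_comp phi (fun n => 6 * harmonic n) phicvg h6).
(* In [V] the point would be at level [mu0] exactly; as 0 lies in [grad J x], (a) would give
   [mu0 <= mu0 / 2]. *)
have nVx : ~ V x.
  move=> [b eb]; have ebx : e b x = mu0 by apply/eqP; rewrite eq_le eb mux.
  have : e b (x - 0) <= mu0 / 2.
    apply: ha => //; exists 0 => //; split; rewrite ?dual0 !normr0 expr0n//.
  by rewrite subr0 ebx; lra.
split => //; last by exists x; rewrite Jx -rrho.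
exists x; split => //; split; last by rewrite Jx -rrho.
apply/eqP; rewrite eq_le; apply/andP; split.
  by apply: ereal_inf_lbound; exists 0 => //; rewrite normr0.
by apply: le_ereal_inf_tmp => _ [g _ <-]; rewrite lee_fin.
Qed.
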